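(* Let $\lambda,\omega\in\mathbb{R}$, $m\in\mathbb{Z}\setminus\{0\}$ and $a\in\mathbb{R}$ with $a\neq 0$. Suppose that $h:[0,\infty)\to\mathbb{R}$ is a finite-energy vortex solution of the initial value problem $$h''(r)+\frac{1}{r}h'(r)-\frac{m^2}{r^2}\sin h(r)\cos h(r)=\lambda\sin h(r)\cos h(r)+\omega\sin h(r),\quad r\in(0,\infty),$$ $$h(0)=0,\qquad h^{(|m|)}(0)=a.$$ Then exactly one of the following holds: (i) $\lambda=\omega=0$ and $h(r)=2\arctan\left[\frac{a}{2\,(|m|!)}\,r^{|m|}\right]$ for all $r\ge 0$. (ii) $\lambda=\omega\neq 0$ and $h(r)$ converges to $(2l+1)\pi$ as $r\to\infty$ for some $l\in\mathbb{Z}$. (iii) $\lambda=-\omega\neq 0$ and $h(r)$ converges to $2l\pi$ as $r\to\infty$ for some $l\in\mathbb{Z}$. (iv) $0<\omega<\lambda$ and $h(r)$ converges to $(2l+1)\pi$ exponentially as $r\to\infty$ for some $l\in\mathbb{Z}$. (v) $-\lambda<\omega<0$ and $h(r)$ converges to $2l\pi$ exponentially as $r\to\infty$ for some $l\in\mathbb{Z}$.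
   Context: A solution of the initial value problem is a real-valued function $h$ on $[0,\infty)$ that is $|m|$ times continuously differentiable on $[0,\infty)$ (one-sided derivatives at $0$), is twice differentiable on $(0,\infty)$ and satisfies the differential equation there, and satisfies the two initial conditions; $h^{(|m|)}$ denotes the derivative of order $|m|$. A solution $h$ is called a vortex solution if $\lim_{r\to\infty}h(r)=k\pi$ for some $k\in\mathbb{Z}$. The solution $h$ has finite energy if $$J(h)=\int_0^{+\infty}\left(h'(r)^2+\frac{m^2}{r^2}\sin^2 h(r)\right)r\,dr<\infty.$$ ''$h(r)$ converges to $c$ exponentially as $r\to\infty$'' means that there are constants $b>0$, $\epsilon>0$ and $R>0$ with $|h(r)-c|\le b e^{-\epsilon r}$ for all $r\ge R$. *)

(* Defs.v *)
From Stdlib Require Import Reals ZArith List.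
From Coquelicot Require Import Coquelicot.
Open Scope R_scope.

(* Functions on [0,oo) are represented by total functions R -> R of which only
   the values on [0,oo) are constrained: derivatives at points of [0,oo) are
   taken relative to that set (Stdlib's [D_in]), so they are one-sided at 0,
   while Coquelicot's [Derive] is used only at points r > 0. *)
Definition nonneg_half_line (r : R) : Prop := 0 <= r.

Fixpoint is_nth_derivative_on (D : R -> Prop) (n : nat) (f g : R -> R) : Prop :=
  match n with
  | O => forall x, D x -> g x = f x
  | S n' => exists f' : R -> R,
      (forall x, D x -> D_in f f' D x) /\ is_nth_derivative_on D n' f' g
  end.

Definition is_continuous_nth_derivative_on
    (D : R -> Prop) (n : nat) (f g : R -> R) : Prop :=
  is_nth_derivative_on D n f g /\ (forall x, D x -> continue_in g D x).

Definition twice_differentiable_at (h : R -> R) (r : R) : Prop :=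
  ex_derive h r /\ ex_derive (Derive h) r.

Definition satisfies_ode (lambda omega : R) (m : Z) (h : R -> R) (r : R) : Prop :=
  Derive (Derive h) r + 1 / r * Derive h r
    - IZR m ^ 2 / r ^ 2 * (sin (h r) * cos (h r))
  = lambda * (sin (h r) * cos (h r)) + omega * sin (h r).

Definition is_solution (lambda omega : R) (m : Z) (a : R) (h : R -> R) : Prop :=
  (forall r, 0 < r ->
     twice_differentiable_at h r /\ satisfies_ode lambda omega m h r) /\
  h 0 = 0 /\
  (exists hm : R -> R,
     is_continuous_nth_derivative_on nonneg_half_line (Z.abs_nat m) h hm /\
     hm 0 = a).

Definition converges_to (h : R -> R) (c : R) : Prop :=
  is_lim h p_infty (Finite c).

Definition converges_exponentially_to (h : R -> R) (c : R) : Prop :=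
  exists b eps R0 : R, 0 < b /\ 0 < eps /\ 0 < R0 /\
    forall r, R0 <= r -> Rabs (h r - c) <= b * exp (- eps * r).

Definition is_vortex (h : R -> R) : Prop :=
  exists k : Z, converges_to h (IZR k * PI).

Definition energy_density (m : Z) (h : R -> R) (r : R) : R :=
  (Derive h r ^ 2 + IZR m ^ 2 / r ^ 2 * sin (h r) ^ 2) * r.

(* For a solution h the density is nonnegative and continuous on (0,oo), so
   J(h) < oo means exactly that this integral, improper at both ends,
   converges. *)
Definition finite_energy (m : Z) (h : R -> R) : Prop :=
  ex_RInt_gen (energy_density m h) (at_right 0) (Rbar_locally p_infty).

(* The default [False] of [nth] rules out indices beyond the list. *)
Definition exactly_one (Ps : list Prop) : Prop :=
  exists! i : nat, nth i Ps False.

(* Main.v *)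
Require Import Defs.
From Stdlib Require Import Reals ZArith List Lra Lia Psatz.
From Coquelicot Require Import Coquelicot.
Import ListNotations.
Open Scope R_scope.

(** Write [c] for the limit [k PI] of [h] and put [u = h - c]. Since
    [sin c = 0] and [cos c = 1] or [-1], the function [u] solves the same
    equation with [omega] replaced by [om = cos c * omega], and [u] tends to 0.
    Linearised at infinity this equation reads [u'' + u'/r = (lambda + om) u],
    so everything depends on the sign of the mass [lambda + om].

    The global information comes from the Pohozaev identity
    [(r^2 G(u) - (r u')^2/2 + m^2/2 sin^2 u)' = 2 r G(u)], where
    [G(x) = (1 - cos x) (lambda/2 (1 + cos x) + om)] is the primitive of the
    right-hand side of the equation that vanishes at the limit of [u]. The
    bracket on the left, called [pohozaev] below, tends to 0 at the origin,
    because [h'] is bounded there.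

    If the mass is negative, [G(u) <= 0] near infinity, hence [pohozaev] is
    eventually nonincreasing. Finite energy together with the equation
    (multiplied by [r sin u]) bounds [- pohozaev / r] by an integrable function,
    and a nonincreasing function with this property must be nonnegative. But the
    term [r^2 G(u)] is then too negative unless [u] vanishes for large [r]
    ([sin_zero_of_negative_mass]), and uniqueness for the equation turns this
    into [h = 0].

    If the mass is positive, [1 - cos u] is eventually decreasing and satisfies
    [y'' >= mu y] with [mu] the mass, hence decays exponentially
    ([exponential_decay_of_positive_mass]). Were [om >= 0], then [G >= 0]
    everywhere and [pohozaev] would be nondecreasing, with limit 0 at the origin
    and arbitrarily small upper bounds near infinity, so [G(u) = 0], which again forces [h = 0] ([sin_zero_of_nonneg_omega]).
    Hence [- lambda < om < 0], and the parity of [k] decides between the two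
    exponential alternatives.

    If the mass vanishes, then either [lambda] and [omega] are nonzero and
    [lambda = - om], which the parity of [k] turns into [lambda = - omega] or
    [lambda = omega], or both are zero. In the latter case [pohozaev = 0] reads
    [(r h')^2 = m^2 sin^2 h]. This first-order equation is solved explicitly
    ([harmonic_profile]).

    The hypothesis [a <> 0] excludes [h = 0], and also identifies the
    integration constant of the explicit solution. Both follow from the
    uniqueness of Taylor coefficients at 0
    ([nth_derivative_of_leading_term]). The five alternatives exclude each other
    by their conditions on [lambda] and [omega] alone. *)

(** * Monotonicity and comparison *)

(** [auto_derive] leaves derivatives of eta-expanded functions behind. *)
Ltac use_derivatives :=
  repeat match goal with
  | H : is_derive ?f ?x ?l |- context [Derive (fun y => ?f y) ?x] =>
      replace (Derive (fun y => f y) x) with l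
        by (symmetry; exact (is_derive_unique f x l H))
  end.

Lemma le_of_derive_nonneg (f f' : R -> R) (a b : R) :
  a <= b ->
  (forall x, a <= x <= b -> is_derive f x (f' x)) ->
  (forall x, a <= x <= b -> 0 <= f' x) ->
  f a <= f b.
Proof.
  intros Hab Hd Hpos.
  destruct (MVT_gen f a b f') as [c [Hc Heq]];
    rewrite ?(Rmin_left a b Hab), ?(Rmax_right a b Hab) in *.
  - intros x Hx; apply Hd; lra.
  - intros x Hx; apply derivable_continuous_pt.
    exists (f' x); apply is_derive_Reals, Hd; lra.
  - specialize (Hpos c Hc); nra.
Qed.

Lemma eq_of_derive_zero (f : R -> R) (a b : R) :
  a <= b -> (forall x, a <= x <= b -> is_derive f x 0) -> f a = f b.
Proof.
  intros Hab Hd; apply Rle_antisym.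
  - apply (le_of_derive_nonneg f (fun _ => 0)); auto with real.
  - enough (- f a <= - f b) by lra.
    apply (le_of_derive_nonneg (fun x => - f x) (fun _ => 0)); auto with real.
    intros x Hx; replace 0 with (- 0) by ring.
    apply (is_derive_opp f x 0), Hd, Hx.
Qed.

Lemma gronwall_forward (S S' : R -> R) (K a b : R) :
  a <= b ->
  (forall x, a <= x <= b -> is_derive S x (S' x) /\ S' x <= K * S x) ->
  S a <= 0 -> S b <= 0.
Proof.
  intros Hab HS Ha.
  assert (H : - (exp (- K * a) * S a) <= - (exp (- K * b) * S b)).
  { apply (le_of_derive_nonneg (fun x => - (exp (- K * x) * S x))
             (fun x => exp (- K * x) * (K * S x - S' x))); auto.
    - intros x Hx; destruct (HS x Hx) as [Hd _].
      auto_derive; [now exists (S' x) |].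
      use_derivatives; ring.
    - intros x Hx; destruct (HS x Hx) as [_ Hi].
      apply Rmult_le_pos; [left; apply exp_pos | lra]. }
  pose proof (exp_pos (- K * a)); pose proof (exp_pos (- K * b)); nra.
Qed.

Lemma gronwall_backward (S S' : R -> R) (K a b : R) :
  a <= b ->
  (forall x, a <= x <= b -> is_derive S x (S' x) /\ - K * S x <= S' x) ->
  S b <= 0 -> S a <= 0.
Proof.
  intros Hab HS Hb.
  assert (H : exp (K * a) * S a <= exp (K * b) * S b).
  { apply (le_of_derive_nonneg (fun x => exp (K * x) * S x)
             (fun x => exp (K * x) * (K * S x + S' x))); auto.
    - intros x Hx; destruct (HS x Hx) as [Hd _].
      auto_derive; [now exists (S' x) |].
      use_derivatives; ring.
    - intros x Hx; destruct (HS x Hx) as [_ Hi].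
      apply Rmult_le_pos; [left; apply exp_pos | lra]. }
  pose proof (exp_pos (K * a)); pose proof (exp_pos (K * b)); nra.
Qed.

(** Solutions of [r y' = q y] with bounded [q] that vanish once vanish
    everywhere: on each compact interval of [(0,oo)] the square [y^2] obeys the
    two Gronwall inequalities. *)
Lemma linear_ode_zero (y q : R -> R) (K r0 : R) :
  0 <= K -> 0 < r0 ->
  (forall r, 0 < r -> is_derive y r (q r / r * y r)) ->
  (forall r, 0 < r -> Rabs (q r) <= K) ->
  y r0 = 0 -> forall r, 0 < r -> y r = 0.
Proof.
  intros HK Hr0 Hd Hq Hy r Hr.
  enough (y r ^ 2 <= 0) by nra.
  assert (HD : forall s, 0 < s ->
            is_derive (fun x => y x ^ 2) s (2 * (q s / s) * y s ^ 2)).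
  { intros s Hs; specialize (Hd s Hs).
    auto_derive; [now exists (q s / s * y s) |].
    use_derivatives; ring. }
  assert (HB : forall a s, 0 < a <= s -> Rabs (q s / s) <= K / a).
  { intros a s Hs; unfold Rdiv; rewrite Rabs_mult, (Rabs_pos_eq (/ s)).
    - apply Rmult_le_compat; [apply Rabs_pos | | apply Hq; lra |].
      + left; apply Rinv_0_lt_compat; lra.
      + apply Rinv_le_contravar; lra.
    - left; apply Rinv_0_lt_compat; lra. }
  destruct (Rle_dec r0 r) as [Hle | Hgt].
  - apply (gronwall_forward (fun x => y x ^ 2)
             (fun s => 2 * (q s / s) * y s ^ 2) (2 * (K / r0)) r0 r); auto.
    + intros s Hs; split; [apply HD; lra |].
      specialize (HB r0 s ltac:(lra)); apply Rabs_le_between in HB.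
      pose proof (pow2_ge_0 (y s)); nra.
    + rewrite Hy; lra.
  - apply (gronwall_backward (fun x => y x ^ 2)
             (fun s => 2 * (q s / s) * y s ^ 2) (2 * (K / r)) r r0); [lra | |].
    + intros s Hs; split; [apply HD; lra |].
      specialize (HB r s ltac:(lra)); apply Rabs_le_between in HB.
      pose proof (pow2_ge_0 (y s)); nra.
    + rewrite Hy; lra.
Qed.

(** A derivative at least [c / r] makes [f - c ln] nondecreasing; this is how
    the divergence of [dr / r] at infinity is used. *)
Lemma unbounded_of_derive_ge_inv (f f' : R -> R) (c R0 B : R) :
  0 < c -> 0 < R0 ->
  (forall r, R0 <= r -> is_derive f r (f' r) /\ c / r <= f' r) ->
  exists R1, R0 <= R1 /\ forall r, R1 <= r -> B <= f r.
Proof.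
  intros Hc HR0 Hf.
  exists (Rmax R0 (exp ((B - f R0) / c + ln R0))).
  split; [apply Rmax_l |]; intros r Hr.
  pose proof (Rmax_l R0 (exp ((B - f R0) / c + ln R0))).
  pose proof (Rmax_r R0 (exp ((B - f R0) / c + ln R0))).
  assert (H1 : f R0 - c * ln R0 <= f r - c * ln r).
  { apply (le_of_derive_nonneg (fun x => f x - c * ln x)
             (fun x => f' x - c / x)); [lra | |].
    - intros x Hx; destruct (Hf x ltac:(lra)) as [Hd _].
      auto_derive; [split; [now exists (f' x) | lra] |].
      use_derivatives; field; lra.
    - intros x Hx; destruct (Hf x ltac:(lra)) as [_ Hi]; lra. }
  assert (H2 : (B - f R0) / c + ln R0 <= ln r).
  { rewrite <- (ln_exp ((B - f R0) / c + ln R0)).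
    apply ln_le; [apply exp_pos | lra]. }
  apply (Rmult_le_compat_l c) in H2; [| lra].
  replace (c * ((B - f R0) / c + ln R0)) with (B - f R0 + c * ln R0) in H2
    by (field; lra).
  lra.
Qed.

(** * Elementary trigonometric bounds *)

Lemma sin_sq_factor (x : R) : sin x ^ 2 = (1 - cos x) * (1 + cos x).
Proof. pose proof (sin2_cos2 x); unfold Rsqr in *; lra. Qed.

Lemma abs_sin_le x : Rabs (sin x) <= Rabs x.
Proof.
  destruct (MVT_gen sin 0 x cos) as [c [_ Heq]].
  - intros y _; apply is_derive_Reals, derivable_pt_lim_sin.
  - intros y _; apply continuity_sin.
  - rewrite sin_0, !Rminus_0_r in Heq; rewrite Heq, Rabs_mult.
    assert (Rabs (cos c) <= 1) by (apply Rabs_le, COS_bound).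
    pose proof (Rabs_pos x); nra.
Qed.

Lemma one_minus_cos_le_abs x : 1 - cos x <= Rabs x.
Proof.
  replace x with (2 * (x / 2)) at 1 by field; rewrite cos_2a_sin.
  pose proof (abs_sin_le (x / 2)) as Hle; pose proof (SIN_bound (x / 2)).
  assert (Hh : Rabs (x / 2) = Rabs x / 2)
    by (unfold Rdiv; rewrite Rabs_mult, (Rabs_pos_eq (/ 2)); lra).
  assert (Rabs (sin (x / 2)) <= 1) by (apply Rabs_le; lra).
  replace (1 - (1 - 2 * sin (x / 2) * sin (x / 2)))
    with (2 * sin (x / 2) ^ 2) by ring.
  rewrite <- (pow2_abs (sin (x / 2))); pose proof (Rabs_pos (sin (x / 2))); nra.
Qed.

Lemma half_le_abs_sin x : Rabs x <= 1 -> x ^ 2 / 4 <= sin x ^ 2.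
Proof.
  assert (Hpos : forall y, 0 <= y <= 1 -> y / 2 <= sin y).
  { intros y Hy.
    enough (sin 0 - 0 / 2 <= sin y - y / 2) by (rewrite sin_0 in *; lra).
    apply (le_of_derive_nonneg (fun z => sin z - z / 2) (fun z => cos z - 1 / 2));
      [lra | |]; intros z Hz.
    - auto_derive; auto; field.
    - pose proof PI2_3_2; rewrite <- cos_PI3.
      enough (cos (PI / 3) <= cos z) by lra.
      apply cos_decr_1; lra. }
  intros Hx; apply Rabs_le_between in Hx.
  destruct (Rle_dec 0 x) as [H | H].
  - specialize (Hpos x ltac:(lra)); nra.
  - specialize (Hpos (- x) ltac:(lra)); rewrite sin_neg in Hpos; nra.
Qed.

Lemma atan_sub_id_cubic x : Rabs (atan x - x) <= Rabs x ^ 3.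
Proof.
  assert (Hpos : forall y, 0 <= y -> 0 <= y - atan y <= y ^ 3 / 3).
  { intros y Hy; split.
    - replace 0 with (0 - atan 0) by (rewrite atan_0; ring).
      apply (le_of_derive_nonneg (fun z => z - atan z)
        (fun z => z ^ 2 / (1 + z ^ 2)) 0 y); auto; intros z _.
      + auto_derive; auto. pose proof (pow2_ge_0 z); field; nra.
      + pose proof (pow2_ge_0 z); apply Rdiv_le_0_compat; lra.
    - enough (0 ^ 3 / 3 - 0 + atan 0 <= y ^ 3 / 3 - y + atan y)
        by (rewrite atan_0 in *; lra).
      apply (le_of_derive_nonneg (fun z => z ^ 3 / 3 - z + atan z)
        (fun z => z ^ 2 * (z ^ 2 / (1 + z ^ 2))) 0 y); auto; intros z _.
      + auto_derive; auto. pose proof (pow2_ge_0 z); field; nra.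
      + pose proof (pow2_ge_0 z).
        apply Rmult_le_pos; auto; apply Rdiv_le_0_compat; lra. }
  destruct (Rle_dec 0 x) as [Hx | Hx].
  - specialize (Hpos x Hx); rewrite (Rabs_pos_eq x Hx).
    pose proof (pow_le x 3 Hx); apply Rabs_le; lra.
  - specialize (Hpos (- x) ltac:(lra)); rewrite atan_opp in Hpos.
    rewrite (Rabs_left x) by lra.
    pose proof (pow_le (- x) 3 ltac:(lra)); apply Rabs_le; lra.
Qed.

(** * The radial equation and its Pohozaev identity *)

(** The equation as a first-order system for [u] and [v = u'], with [M] in place
    of [m^2]. *)
Definition radial_solution (M lam om : R) (u v : R -> R) : Prop :=
  forall r, 0 < r ->
    is_derive u r (v r) /\
    is_derive v r (sin (u r) * ((M / r ^ 2 + lam) * cos (u r) + om) - v r / r).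

(** The primitive of [lam sin cos + om sin] that vanishes at 0, the limit of the
    profiles to which it is applied. *)
Definition potential (lam om x : R) : R :=
  (1 - cos x) * (lam / 2 * (1 + cos x) + om).

Definition pohozaev (M lam om : R) (u v : R -> R) (r : R) : R :=
  r ^ 2 * potential lam om (u r) - (r * v r) ^ 2 / 2 + M / 2 * sin (u r) ^ 2.

Definition regular_at_0 (u v : R -> R) : Prop :=
  forall eps, 0 < eps -> exists delta, 0 < delta /\
    forall r, 0 < r < delta -> Rabs (sin (u r)) <= eps /\ Rabs (r * v r) <= eps.

Definition vanishes_at_infinity (u : R -> R) : Prop :=
  forall eps, 0 < eps -> exists R0, 0 < R0 /\
    forall r, R0 <= r -> Rabs (u r) <= eps.

(** Finite energy, expressed by a primitive [T] of the energy density that stays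
    bounded at infinity, the form in which it enters differential inequalities. *)
Definition bounded_energy (M : R) (u v : R -> R) : Prop :=
  exists (T : R -> R) (R0 B : R), 0 < R0 /\
    (forall r, 0 < r -> is_derive T r (r * v r ^ 2 + M / r * sin (u r) ^ 2)) /\
    (forall r, R0 <= r -> Rabs (T r) <= B).

(** The Pohozaev identity: the equation multiplied by [r^2 u']. *)
Lemma is_derive_pohozaev M lam om u v r :
  radial_solution M lam om u v -> 0 < r ->
  is_derive (pohozaev M lam om u v) r (2 * r * potential lam om (u r)).
Proof.
  intros Hs Hr; destruct (Hs r Hr) as [Hu Hv].
  unfold pohozaev, potential; auto_derive.
  - repeat split; eexists; eassumption.
  - use_derivatives.
    field; lra.
Qed.

(** The equation tested against [r sin u]. The function [r v sin u] is [r] times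
    the derivative of [1 - cos u], so this is an equation for [1 - cos u]; that
    function replaces [u^2] throughout, because the nonlinearity is polynomial
    in [cos u]. *)
Lemma is_derive_cos_rate M lam om u v r :
  radial_solution M lam om u v -> 0 < r ->
  is_derive (fun r => r * v r * sin (u r)) r
    (r * v r ^ 2 * cos (u r)
     + r * sin (u r) ^ 2 * ((M / r ^ 2 + lam) * cos (u r) + om)).
Proof.
  intros Hs Hr; destruct (Hs r Hr) as [Hu Hv].
  auto_derive.
  - repeat split; eexists; eassumption.
  - use_derivatives.
    field; lra.
Qed.

Lemma is_derive_one_minus_cos M lam om u v r :
  radial_solution M lam om u v -> 0 < r ->
  is_derive (fun r => 1 - cos (u r)) r (v r * sin (u r)).
Proof.
  intros Hs Hr; destruct (Hs r Hr) as [Hu _].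
  auto_derive; [eexists; eassumption |].
  use_derivatives; ring.
Qed.

Lemma cos_near_one_at_infinity u eps :
  vanishes_at_infinity u -> 0 < eps ->
  exists R0, 0 < R0 /\ forall r, R0 <= r -> 1 - eps <= cos (u r).
Proof.
  intros Hu Heps; destruct (Hu eps Heps) as [R0 [HR0 HR]].
  exists R0; split; auto; intros r Hr; specialize (HR r Hr).
  pose proof (one_minus_cos_le_abs (u r)); lra.
Qed.

(** Backward uniqueness for the zero solution. The quantity [sin^2 u + v^2]
    obeys a Gronwall inequality because the nonlinearity has the factor
    [sin u]. *)
Lemma sin_zero_extends M lam om u v r0 :
  radial_solution M lam om u v -> 0 < r0 -> sin (u r0) = 0 -> v r0 = 0 ->
  forall r, 0 < r <= r0 -> sin (u r) = 0.
Proof.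
  intros Hs Hr0 H0 H1 r Hr.
  (* The coefficients are largest at the left end [r] of the interval; [2 / r]
     absorbs the damping term. *)
  set (K := 1 + (Rabs M / r ^ 2 + Rabs lam + Rabs om) + 2 / r).
  enough (sin (u r) ^ 2 + v r ^ 2 <= 0) by nra.
  apply (gronwall_backward (fun r => sin (u r) ^ 2 + v r ^ 2)
    (fun r => 2 * sin (u r) * cos (u r) * v r
       + 2 * v r * (sin (u r) * ((M / r ^ 2 + lam) * cos (u r) + om) - v r / r))
    K r r0); [lra | | rewrite H0, H1; lra].
  intros s Hs'; destruct (Hs s ltac:(lra)) as [Hu Hv]; split.
  - auto_derive.
    + repeat split; eexists; eassumption.
    + use_derivatives; ring.
  - assert (Hc := COS_bound (u s)).
    assert (HM : Rabs (M / s ^ 2) <= Rabs M / r ^ 2).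
    { unfold Rdiv; rewrite Rabs_mult; apply Rmult_le_compat_l;
        [apply Rabs_pos |].
      rewrite Rabs_pos_eq.
      - apply Rinv_le_contravar; [apply pow_lt; lra | apply pow_incr; lra].
      - left; apply Rinv_0_lt_compat, pow_lt; lra. }
    assert (Hrs : 0 < / s <= / r).
    { split; [apply Rinv_0_lt_compat; lra | apply Rinv_le_contravar; lra]. }
    set (A := cos (u s) + ((M / s ^ 2 + lam) * cos (u s) + om)).
    assert (HA : Rabs A <= 1 + (Rabs M / r ^ 2 + Rabs lam + Rabs om)).
    { unfold A; eapply Rle_trans; [apply Rabs_triang |].
      apply Rplus_le_compat; [apply Rabs_le; lra |].
      eapply Rle_trans; [apply Rabs_triang |].
      apply Rplus_le_compat_r; rewrite Rabs_mult.
      assert (Rabs (cos (u s)) <= 1) by (apply Rabs_le; lra).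
      pose proof (Rabs_triang (M / s ^ 2) lam).
      pose proof (Rabs_pos (M / s ^ 2 + lam)); pose proof (Rabs_pos (cos (u s))).
      nra. }
    apply Rabs_le_between in HA.
    replace (2 * sin (u s) * cos (u s) * v s +
      2 * v s * (sin (u s) * ((M / s ^ 2 + lam) * cos (u s) + om) - v s / s))
      with (2 * sin (u s) * v s * A - 2 * v s ^ 2 * / s)
      by (unfold A, Rdiv; ring).
    unfold K, Rdiv at 2.
    set (L := 1 + (Rabs M / r ^ 2 + Rabs lam + Rabs om)) in *.
    assert (- L * (sin (u s) ^ 2 + v s ^ 2) <= 2 * sin (u s) * v s * A).
    { pose proof (pow2_ge_0 (sin (u s) - v s)).
      pose proof (pow2_ge_0 (sin (u s) + v s)). nra. }
    pose proof (pow2_ge_0 (v s)); pose proof (pow2_ge_0 (sin (u s))).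
    nra.
Qed.

(** * Positive mass: exponential decay *)
Lemma sin2_rate_lower M mu lam om c r :
  0 <= M -> 0 < r -> 0 <= c <= 1 -> mu <= (1 + c) * (lam * c + om) ->
  mu * (1 - c) <= (1 - c) * (1 + c) * ((M / r ^ 2 + lam) * c + om).
Proof.
  intros HM Hr Hc H.
  assert (0 <= M / r ^ 2).
  { apply Rmult_le_pos; [lra |]. left; apply Rinv_0_lt_compat, pow_lt, Hr. }
  assert (0 <= (1 - c) * (1 + c) * (M / r ^ 2 * c)).
  { apply Rmult_le_pos; [nra |]. apply Rmult_le_pos; lra. }
  nra.
Qed.


(** Once [cos u] is close to 1, [y = 1 - cos u] satisfies [(r y')' >= mu r y].
    Thus [r y'] is nondecreasing, and it cannot become positive, since then
    [y' >= c / r] would make [y] unbounded. With [y' <= 0] the damping term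
    [y' / r] has a favourable sign and [y'' >= mu y] remains. For [k = sqrt mu],
    [z = y' + k y] satisfies [z' >= k z]; a positive value of [z] would persist
    and keep [y] away from 0, so [z <= 0], which is exponential decay of [y]. *)
Lemma exponential_decay_of_positive_mass M lam om u v :
  0 <= M -> radial_solution M lam om u v -> vanishes_at_infinity u ->
  0 < lam + om ->
  exists b k R0, 0 < b /\ 0 < k /\ 0 < R0 /\
    forall r, R0 <= r -> 1 - cos (u r) <= b * exp (- k * r).
Proof.
  intros HM Hs Hu Hmu.
  set (mu := lam + om) in *.
  (* For [c >= 1 - d] this gives [(1 + c) (lam c + om) >= mu], where the value
     at [c = 1] is [2 mu]. *)
  set (d := mu / (mu + 3 * Rabs lam + mu)).
  pose proof (Rabs_pos lam) as Hl.
  assert (Hd : 0 < d <= 1 /\ d * (mu + 3 * Rabs lam + mu) = mu).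
  { unfold d; split; [split |].
    - apply Rdiv_lt_0_compat; lra.
    - apply Rle_div_l; lra.
    - field; lra. }
  destruct (cos_near_one_at_infinity u d Hu) as [R0 [HR0 Hcos]]; [lra |].
  set (y := fun r => 1 - cos (u r)).
  set (y' := fun r => v r * sin (u r)).
  set (W := fun r => r * v r * sin (u r)).
  set (W' := fun r => r * v r ^ 2 * cos (u r)
     + r * sin (u r) ^ 2 * ((M / r ^ 2 + lam) * cos (u r) + om)).
  assert (HW : forall r, 0 < r -> is_derive W r (W' r))
    by (intros r Hr; apply is_derive_cos_rate; auto).
  assert (Hy : forall r, 0 < r -> is_derive y r (y' r))
    by (intros r Hr; eapply is_derive_one_minus_cos; eauto).
  assert (Hy0 : forall r, 0 <= y r)
    by (intro r; unfold y; pose proof (COS_bound (u r)); lra).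
  assert (HW' : forall r, R0 <= r -> mu * r * y r <= W' r).
  { intros r Hr; specialize (Hcos r Hr); pose proof (COS_bound (u r)).
    unfold W', y; rewrite sin_sq_factor.
    assert (H1 := sin2_rate_lower M mu lam om (cos (u r)) r HM
      ltac:(lra) ltac:(lra)).
    assert (0 <= r * v r ^ 2 * cos (u r)).
    { apply Rmult_le_pos; [| lra].
      apply Rmult_le_pos; [lra | apply pow2_ge_0]. }
    enough (mu * (1 - cos (u r)) <= (1 - cos (u r)) * (1 + cos (u r)) *
       ((M / r ^ 2 + lam) * cos (u r) + om)) by nra.
    apply H1; set (c := cos (u r)) in *.
    replace om with (mu - lam) by (unfold mu; ring).
    pose proof (Rle_abs lam); pose proof (Rle_abs (- lam)) as H3.
    rewrite Rabs_Ropp in H3.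
    assert (lam * (1 - c) <= Rabs lam * d) by nra.
    assert (- (Rabs lam * d) <= lam * (1 - c)) by nra.
    nra. }
  assert (HWneg : forall r, R0 <= r -> W r <= 0).
  { intros r1 Hr1; apply Rnot_lt_le; intro Hp.
    destruct (unbounded_of_derive_ge_inv y y' (W r1) r1 3) as [R1 [HR1 Hbig]];
      [lra | lra | |].
    - intros r Hr; split; [apply Hy; lra |].
      assert (W r1 <= W r).
      { apply (le_of_derive_nonneg W W'); [lra | |]; intros x Hx.
        - apply HW; lra.
        - specialize (HW' x ltac:(lra)); specialize (Hy0 x).
          assert (0 <= mu * x * y x) by (apply Rmult_le_pos; nra); lra. }
      replace (y' r) with (W r / r) by (unfold W, y'; field; lra).
      apply Rmult_le_compat_r; [left; apply Rinv_0_lt_compat; lra | lra].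
    - specialize (Hbig R1 ltac:(lra)); unfold y in Hbig.
      pose proof (COS_bound (u R1)); lra. }
  assert (Hy'neg : forall r, R0 <= r -> y' r <= 0).
  { intros r Hr; specialize (HWneg r Hr).
    apply (Rmult_le_reg_l r); [lra |]; unfold W, y' in *; lra. }
  set (k := sqrt mu).
  assert (Hk : 0 < k /\ k * k = mu)
    by (split; [apply sqrt_lt_R0, Hmu | apply sqrt_sqrt; lra]).
  set (z := fun r => y' r + k * y r).
  assert (Hz : forall r, R0 <= r ->
     is_derive z r (W' r / r - y' r / r + k * y' r)).
  { intros r Hr; destruct (Hs r ltac:(lra)) as [Hu1 Hv1].
    unfold z, y', y, W'; auto_derive; [repeat split; eexists; eassumption |].
    use_derivatives; field; lra. }
  assert (Hz' : forall r, R0 <= r ->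
     k * z r <= W' r / r - y' r / r + k * y' r).
  { intros r Hr; specialize (HW' r Hr); specialize (Hy'neg r Hr).
    assert (Hir : 0 < / r) by (apply Rinv_0_lt_compat; lra).
    assert (mu * y r <= W' r / r).
    { apply (Rmult_le_reg_l r); [lra |].
      replace (r * (W' r / r)) with (W' r) by (field; lra); lra. }
    assert (y' r / r <= 0) by (unfold Rdiv; nra).
    unfold z; nra. }
  assert (Hzneg : forall r, R0 <= r -> z r <= 0).
  { intros r1 Hr1; apply Rnot_lt_le; intro Hp.
    destruct (cos_near_one_at_infinity u (z r1 / (2 * k)) Hu) as [R1 [HR1 Hc1]].
    { apply Rdiv_lt_0_compat; lra. }
    set (r := Rmax r1 R1).
    assert (Hrr : r1 <= r /\ R1 <= r)
      by (split; [apply Rmax_l | apply Rmax_r]).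
    assert (Hg : exp (- k * r1) * z r1 <= exp (- k * r) * z r).
    { apply (le_of_derive_nonneg (fun x => exp (- k * x) * z x)
        (fun x => exp (- k * x) * ((W' x / x - y' x / x + k * y' x) - k * z x)));
        [lra | |]; intros x Hx.
      - specialize (Hz x ltac:(lra)).
        auto_derive; [repeat split; eexists; eassumption |].
        use_derivatives; ring.
      - specialize (Hz' x ltac:(lra)).
        apply Rmult_le_pos; [left; apply exp_pos | lra]. }
    assert (He : exp (- k * r) <= exp (- k * r1)).
    { destruct (Req_dec r r1) as [-> |]; [lra |].
      left; apply exp_increasing; nra. }
    pose proof (exp_pos (- k * r)); pose proof (exp_pos (- k * r1)).
    assert (Hzle : z r1 <= z r) by nra.
    specialize (Hy'neg r ltac:(lra)); specialize (Hc1 r ltac:(lra)).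
    assert (k * y r <= z r1 / 2).
    { replace (z r1 / 2) with (k * (z r1 / (2 * k))) by (field; lra).
      apply Rmult_le_compat_l; [lra |]; unfold y; lra. }
    unfold z at 2 in Hzle; lra. }
  exists ((y R0 + 1) * exp (k * R0)), k, R0.
  specialize (Hy0 R0) as Hy00.
  split; [apply Rmult_lt_0_compat; [lra | apply exp_pos] |].
  split; [lra |]; split; [lra |]; intros r Hr.
  assert (Hg : - (exp (k * R0) * y R0) <= - (exp (k * r) * y r)).
  { apply (le_of_derive_nonneg (fun x => - (exp (k * x) * y x))
      (fun x => - (exp (k * x) * z x))); [lra | |]; intros x Hx.
    - specialize (Hy x ltac:(lra)).
      auto_derive; [repeat split; eexists; eassumption |].
      use_derivatives; unfold z; ring.
    - specialize (Hzneg x ltac:(lra)); pose proof (exp_pos (k * x)); nra. }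
  fold (y r).
  apply (Rmult_le_reg_l (exp (k * r))); [apply exp_pos |].
  replace (exp (k * r) * ((y R0 + 1) * exp (k * R0) * exp (- k * r)))
    with ((y R0 + 1) * exp (k * R0) * (exp (k * r) * exp (- k * r))) by ring.
  rewrite <- exp_plus; replace (k * r + - k * r) with 0 by ring; rewrite exp_0.
  pose proof (exp_pos (k * R0)); nra.
Qed.

(** For a nonnegative potential [pohozaev] is nondecreasing. Its limit at 0 is
    nonnegative and, by hypothesis, it takes values below every [eps] near
    infinity; hence it is 0, and so is its derivative. *)
Lemma pohozaev_nonneg_potential M lam om u v :
  0 <= M -> radial_solution M lam om u v -> regular_at_0 u v ->
  (forall eps R0, 0 < eps -> exists r, R0 <= r /\ pohozaev M lam om u v r <= eps) ->
  (forall x, 0 <= potential lam om x) ->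
  forall r, 0 < r -> potential lam om (u r) = 0.
Proof.
  intros HM Hs H0 Hinf HG.
  set (Q := pohozaev M lam om u v).
  assert (HQ : forall r, 0 < r -> is_derive Q r (2 * r * potential lam om (u r)))
    by (intros; apply is_derive_pohozaev; auto).
  assert (Hmono : forall a b, 0 < a <= b -> Q a <= Q b).
  { intros a b Hab.
    apply (le_of_derive_nonneg Q (fun r => 2 * r * potential lam om (u r)));
      [lra | |]; intros x Hx; [apply HQ; lra |].
    specialize (HG (u x)); apply Rmult_le_pos; lra. }
  assert (Hpos : forall r, 0 < r -> 0 <= Q r).
  { intros r Hr; apply Rnot_lt_le; intro Hn.
    destruct (H0 (Rmin 1 (- Q r))) as [d [Hd Hsmall]].
    { apply Rmin_glb_lt; lra. }
    set (s := Rmin r (d / 2)).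
    assert (Hsr : 0 < s /\ s <= r /\ s < d).
    { unfold s; split; [apply Rmin_glb_lt; lra |]; split; [apply Rmin_l |].
      pose proof (Rmin_r r (d / 2)); lra. }
    destruct (Hsmall s ltac:(lra)) as [_ Hv].
    assert (Hle : - (s * v s) ^ 2 / 2 <= Q s).
    { unfold Q, pohozaev; pose proof (HG (u s)).
      pose proof (pow2_ge_0 (sin (u s))); pose proof (pow2_ge_0 s); nra. }
    specialize (Hmono s r ltac:(lra)).
    pose proof (Rmin_l 1 (- Q r)); pose proof (Rmin_r 1 (- Q r)).
    apply Rabs_le_between in Hv.
    assert ((s * v s) ^ 2 <= 1 * (- Q r)) by nra.
    lra. }
  assert (Hneg : forall r, 0 < r -> Q r <= 0).
  { intros r Hr; apply Rnot_lt_le; intro Hp.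
    destruct (Hinf (Q r / 2) r) as [s [Hs1 Hs2]]; [lra |].
    fold Q in Hs2; specialize (Hmono r s ltac:(lra)); lra. }
  intros r Hr.
  enough (2 * r * potential lam om (u r) = 0) by nra.
  rewrite <- (is_derive_unique _ _ _ (HQ r Hr)).
  apply is_derive_unique.
  apply (is_derive_ext_loc (fun _ => 0)); [| apply (is_derive_const 0)].
  assert (Hr2 : 0 < r / 2) by lra.
  exists (mkposreal _ Hr2); intros t Ht.
  apply Rabs_lt_between in Ht; simpl in Ht; unfold minus, plus, opp in Ht;
    simpl in Ht.
  symmetry; apply Rle_antisym; [apply Hneg | apply Hpos]; lra.
Qed.

(** From [exp x >= (x / 3)^3], which is [exp y >= y] cubed at [y = x / 3]. *)
Lemma square_exp_small b k eps R0 : 0 < b -> 0 < k -> 0 < eps ->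
  exists r, R0 <= r /\ 0 < r /\ (1 + r ^ 2) * (b * exp (- k * r)) <= eps.
Proof.
  intros Hb Hk He.
  (* [54 = 2 * 27]: the factor 2 bounds [1 + r^2] by [2 r^2] and 27 is [3^3]. *)
  set (r := Rmax R0 (Rmax 1 (54 * b / (k ^ 3 * eps)))).
  pose proof (Rmax_l R0 (Rmax 1 (54 * b / (k ^ 3 * eps)))).
  pose proof (Rmax_r R0 (Rmax 1 (54 * b / (k ^ 3 * eps)))).
  pose proof (Rmax_l 1 (54 * b / (k ^ 3 * eps))).
  pose proof (Rmax_r 1 (54 * b / (k ^ 3 * eps))).
  fold r in H, H0.
  exists r; split; [lra |]; split; [lra |].
  assert (Hk3 : 0 < k ^ 3) by (apply pow_lt; lra).
  assert (Hr : 54 * b <= r * (k ^ 3 * eps)).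
  { apply Rle_div_l; [apply Rmult_lt_0_compat; lra | lra]. }
  assert (Hx : (k * r / 3) ^ 3 <= exp (k * r)).
  { replace (k * r) with (k * r / 3 + (k * r / 3 + k * r / 3)) at 2 by field.
    rewrite !exp_plus.
    assert (0 <= k * r / 3 <= exp (k * r / 3)).
    { pose proof (exp_ineq1_le (k * r / 3)).
      assert (0 < k * r) by (apply Rmult_lt_0_compat; lra). lra. }
    replace (exp (k * r / 3) * (exp (k * r / 3) * exp (k * r / 3)))
      with (exp (k * r / 3) ^ 3) by ring.
    apply pow_incr; lra. }
  assert (Hi : exp (- k * r) * exp (k * r) = 1).
  { rewrite <- exp_plus; replace (- k * r + k * r) with 0 by ring; apply exp_0. }
  apply (Rmult_le_reg_r (exp (k * r))); [apply exp_pos |].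
  replace ((1 + r ^ 2) * (b * exp (- k * r)) * exp (k * r))
    with ((1 + r ^ 2) * b * (exp (- k * r) * exp (k * r))) by ring.
  rewrite Hi.
  apply Rle_trans with (eps * (k * r / 3) ^ 3); [| apply Rmult_le_compat_l; lra].
  set (P := r * (k ^ 3 * eps)) in *.
  replace (eps * (k * r / 3) ^ 3) with (P * r ^ 2 / 27) by (unfold P; field).
  assert (1 <= r ^ 2) by nra.
  assert (54 * b * r ^ 2 <= P * r ^ 2) by (apply Rmult_le_compat_r; lra).
  nra.
Qed.

(** The factor [lam / 2 (1 + c) + om] of the potential is affine in [c], with
    values [lam + om > 0] at [c = 1] and [om >= 0] at [c = -1]; so the potential
    is nonnegative and vanishes only where [c] is 1 or -1. Exponential decay
    beats the factor [r^2] in [pohozaev], and its remaining negative term only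
    helps. *)
Lemma sin_zero_of_nonneg_omega M lam om u v :
  0 <= M -> radial_solution M lam om u v -> regular_at_0 u v ->
  vanishes_at_infinity u -> 0 < lam + om -> 0 <= om ->
  forall r, 0 < r -> sin (u r) = 0.
Proof.
  intros HM Hs H0 Hu Hmu Hom r Hr.
  assert (HG : forall c, -1 <= c <= 1 -> 0 <= lam / 2 * (1 + c) + om).
  { intros c Hc. replace (lam / 2 * (1 + c) + om) with
      ((lam + om) * ((1 + c) / 2) + om * ((1 - c) / 2)) by field.
    nra. }
  assert (HG0 : potential lam om (u r) = 0).
  { apply (pohozaev_nonneg_potential M lam om u v); auto.
    - intros eps R0 He.
      destruct (exponential_decay_of_positive_mass M lam om u v)
        as [b [k [R1 [Hb [Hk [HR1 Hdec]]]]]]; auto.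
      set (C := Rabs lam + Rabs om + M + 1).
      pose proof (Rabs_pos lam); pose proof (Rabs_pos om).
      destruct (square_exp_small (C * b) k eps (Rmax R0 R1))
        as [s [Hs1 [Hs2 Hs3]]];
        [apply Rmult_lt_0_compat; unfold C; lra | lra | lra |].
      pose proof (Rmax_l R0 R1); pose proof (Rmax_r R0 R1).
      exists s; split; [lra |].
      specialize (Hdec s ltac:(lra)).
      eapply Rle_trans; [| exact Hs3].
      apply Rle_trans with ((1 + s ^ 2) * (C * (1 - cos (u s)))).
      2: { apply Rmult_le_compat_l; [pose proof (pow2_ge_0 s); lra |].
           rewrite Rmult_assoc; apply Rmult_le_compat_l; [unfold C; lra | auto]. }
      unfold pohozaev, potential; rewrite sin_sq_factor.
      pose proof (COS_bound (u s)); set (c := cos (u s)) in *.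
      pose proof (Rle_abs lam); pose proof (Rle_abs om).
      assert (lam / 2 * (1 + c) <= Rabs lam) by nra.
      assert (lam / 2 * (1 + c) + om <= C) by (unfold C; lra).
      pose proof (pow2_ge_0 s); pose proof (pow2_ge_0 (s * v s)).
      assert (s ^ 2 * ((1 - c) * (lam / 2 * (1 + c) + om)) <= s ^ 2 * (C * (1 - c)))
        by (apply Rmult_le_compat_l; nra).
      assert (M / 2 * ((1 - c) * (1 + c)) <= C * (1 - c)).
      { replace (M / 2 * ((1 - c) * (1 + c))) with ((M * ((1 + c) / 2)) * (1 - c))
          by field.
        apply Rmult_le_compat_r; [lra |]. unfold C; nra. }
      lra.
    - intro x; pose proof (COS_bound x); unfold potential.
      apply Rmult_le_pos; [lra | apply HG; lra]. }
  unfold potential in HG0.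
  enough (sin (u r) ^ 2 = 0) by nra.
  rewrite sin_sq_factor; pose proof (COS_bound (u r)).
  set (c := cos (u r)) in *.
  apply Rmult_integral in HG0; destruct HG0 as [-> | HG0]; [ring |].
  assert (Hsum : (lam + om) * (1 + c) + om * (1 - c) = 0) by lra.
  assert (Hc1 : 1 + c = 0) by nra.
  rewrite Hc1; ring.
Qed.

(** * Negative mass: oscillation contradicts finite energy *)

(** Otherwise the energy density would be at least [eps / r] near infinity, and
    the energy infinite. *)
Lemma energy_small_somewhere M u v R0 eps :
  0 <= M -> bounded_energy M u v -> 0 < eps ->
  exists r, R0 <= r /\ 0 < r /\ (r * v r) ^ 2 <= eps.
Proof.
  intros HM [T [R1 [B [HR1 [HT HB]]]]] He.
  destruct (Classical_Prop.classic
    (exists r, R0 <= r /\ 0 < r /\ (r * v r) ^ 2 <= eps)) as [H | Hn]; auto.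
  exfalso.
  pose proof (Rmax_l R0 R1); pose proof (Rmax_r R0 R1).
  set (R2 := Rmax R0 R1) in *.
  destruct (unbounded_of_derive_ge_inv T
    (fun r => r * v r ^ 2 + M / r * sin (u r) ^ 2) eps R2 (B + 1))
    as [R3 [HR3 Hbig]]; [auto | lra | |].
  - intros r Hr; split; [apply HT; lra |].
    assert (Hr' : eps < (r * v r) ^ 2).
    { apply Rnot_le_lt; intro Hle; apply Hn; exists r; repeat split; lra. }
    assert (0 <= M / r * sin (u r) ^ 2).
    { apply Rmult_le_pos; [| apply pow2_ge_0].
      apply Rmult_le_pos; [lra | left; apply Rinv_0_lt_compat; lra]. }
    assert (eps / r <= r * v r ^ 2); [| lra].
    apply Rle_div_l; [lra |]; lra.
  - specialize (Hbig R3 ltac:(lra)); specialize (HB R3 ltac:(lra)).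
    apply Rabs_le_between in HB; lra.
Qed.

(** Let [nu = - (lam + om) > 0], [y = 1 - cos u], [W = r v sin u], and let [T] be
    the primitive of the energy density. Near infinity [W' <= T' - nu r y], so
    [T - W] controls the integral of [r y], while [T] controls that of [r v^2];
    together they control [- pohozaev / r]. Now [- pohozaev] is nondecreasing
    near infinity, so a positive value would give [(3 T - 2 W)' >= c / r],
    although [T] is bounded and [W] is bounded along a sequence. Hence
    [pohozaev >= 0] near infinity, that is
    [r^2 |G(u)| + (r v)^2 / 2 <= M / 2 sin^2 u]; as [|G(u)| >= nu / 2 * y] and
    [sin^2 u <= 2 y], this forces [y = 0] for large [r]. *)
Lemma sin_zero_of_negative_mass M lam om u v :
  0 <= M -> radial_solution M lam om u v ->
  vanishes_at_infinity u -> bounded_energy M u v -> lam + om < 0 ->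
  forall r, 0 < r -> sin (u r) = 0.
Proof.
  intros HM Hs Hu HE Hmu.
  set (nu := - (lam + om)).
  pose proof (Rabs_pos lam) as Hl.
  pose proof (Rle_abs lam) as Hl1; pose proof (Rle_abs (- lam)) as Hl2.
  rewrite Rabs_Ropp in Hl2.
  (* Chosen so that [cos u >= 1 - d] gives the last two bounds of [Hc]
     below; the quantities bounded there are [nu] and [- 2 nu] at [cos u = 1]. *)
  set (d := nu / (2 * nu + 6 * Rabs lam)).
  assert (Hd : 0 < d <= 1 /\ d * (2 * nu + 6 * Rabs lam) = nu).
  { unfold d, nu; split; [split |].
    - apply Rdiv_lt_0_compat; lra.
    - apply Rle_div_l; lra.
    - field; lra. }
  destruct (cos_near_one_at_infinity u d Hu) as [R0 [HR0 Hcos]]; [lra |].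
  pose proof HE as [T [R1 [B [HR1 [HT HB]]]]].
  set (Q := pohozaev M lam om u v).
  set (W := fun r => r * v r * sin (u r)).
  assert (Hc : forall r, R0 <= r ->
    0 <= 1 - cos (u r) /\ 0 <= cos (u r) <= 1 /\
    nu / 2 <= - (lam / 2 * (1 + cos (u r)) + om) <= 2 * nu /\
    (1 + cos (u r)) * (lam * cos (u r) + om) <= - nu).
  { intros r Hr; specialize (Hcos r Hr); pose proof (COS_bound (u r)).
    set (c := cos (u r)) in *.
    replace om with (- nu - lam) by (unfold nu; ring).
    assert (lam * (1 - c) <= Rabs lam * d) by nra.
    assert (- (Rabs lam * d) <= lam * (1 - c)) by nra.
    assert (0 < nu) by (unfold nu; lra).
    repeat split; try lra; try nra. }
  assert (HQneg : forall r1, R0 <= r1 -> 0 <= Q r1).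
  { intros r1 Hr1; apply Rnot_lt_le; intro Hp.
    assert (Hmono : forall r, r1 <= r -> - Q r1 <= - Q r).
    { intros r Hr.
      apply (le_of_derive_nonneg (fun r => - Q r)
        (fun r => - (2 * r * potential lam om (u r)))); [lra | |]; intros x Hx.
      - apply (is_derive_opp Q x), is_derive_pohozaev; auto; lra.
      - destruct (Hc x ltac:(lra)) as [H1 [H2 [H3 H4]]]; unfold potential.
        assert (0 < nu) by (unfold nu; lra).
        assert (0 <= (1 - cos (u x)) * - (lam / 2 * (1 + cos (u x)) + om))
          by (apply Rmult_le_pos; lra).
        nra. }
    set (R2 := Rmax r1 R1).
    pose proof (Rmax_l r1 R1); pose proof (Rmax_r r1 R1); fold R2 in H, H0.
    destruct (unbounded_of_derive_ge_inv (fun r => 3 * T r - 2 * W r)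
      (fun r => 3 * (r * v r ^ 2 + M / r * sin (u r) ^ 2)
        - 2 * (r * v r ^ 2 * cos (u r)
          + r * sin (u r) ^ 2 * ((M / r ^ 2 + lam) * cos (u r) + om)))
      (- Q r1) R2 (3 * B + 3)) as [R3 [HR3 Hbig]]; [lra | lra | |].
    - intros r Hr; split.
      + pose proof (HT r ltac:(lra)) as H1.
        pose proof (is_derive_cos_rate M lam om u v r Hs ltac:(lra)) as H2.
        apply (is_derive_minus (fun r => 3 * T r) (fun r => 2 * W r) r);
          apply is_derive_scal; assumption.
      + specialize (Hmono r ltac:(lra)).
        destruct (Hc r ltac:(lra)) as [H1 [H2 [H3 H4]]].
        assert (H5 : - Q r / r <= 2 * nu * r * (1 - cos (u r)) + r * v r ^ 2 / 2).
        { apply Rle_div_l; [lra |].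
          unfold Q, pohozaev, potential.
          pose proof (pow2_ge_0 (sin (u r))).
          assert (0 <= M / 2 * sin (u r) ^ 2) by (apply Rmult_le_pos; lra).
          assert (r ^ 2 * ((1 - cos (u r)) * - (lam / 2 * (1 + cos (u r)) + om))
            <= r ^ 2 * ((1 - cos (u r)) * (2 * nu))).
          { apply Rmult_le_compat_l; [apply pow2_ge_0 |].
            apply Rmult_le_compat_l; lra. }
          lra. }
        assert (H6 : - Q r1 / r <= - Q r / r).
        { apply Rmult_le_compat_r; [left; apply Rinv_0_lt_compat; lra | lra]. }
        assert (H7 : 0 <= M / r * sin (u r) ^ 2).
        { apply Rmult_le_pos; [| apply pow2_ge_0].
          apply Rmult_le_pos; [lra | left; apply Rinv_0_lt_compat; lra]. }
        assert (H8 : 0 <= r * v r ^ 2)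
          by (apply Rmult_le_pos; [lra | apply pow2_ge_0]).
        replace (r * sin (u r) ^ 2 * ((M / r ^ 2 + lam) * cos (u r) + om))
          with (M / r * sin (u r) ^ 2 * cos (u r)
            + r * (sin (u r) ^ 2 * (lam * cos (u r) + om))) by (field; lra).
        assert (H9 : r * (sin (u r) ^ 2 * (lam * cos (u r) + om))
           <= r * ((1 - cos (u r)) * - nu)).
        { apply Rmult_le_compat_l; [lra |]. rewrite sin_sq_factor, Rmult_assoc.
          apply Rmult_le_compat_l; lra. }
        assert (M / r * sin (u r) ^ 2 * cos (u r) <= M / r * sin (u r) ^ 2) by nra.
        assert (r * v r ^ 2 * cos (u r) <= r * v r ^ 2) by nra.
        lra.
    - destruct (energy_small_somewhere M u v R3 1 HM HE) as [r [Hr1' [Hr2 Hr3]]];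
        [lra |].
      specialize (Hbig r Hr1'); specialize (HB r ltac:(lra)).
      apply Rabs_le_between in HB.
      assert (- W r <= 1).
      { unfold W; pose proof (SIN_bound (u r)).
        assert (-1 <= r * v r <= 1) by nra. nra. }
      lra. }
  assert (Hnu : 0 < nu) by (unfold nu; lra).
  (* Beyond this radius [r^2 nu / 2] exceeds [M]. *)
  set (R2 := Rmax R0 (1 + 2 * M / nu)).
  assert (HR2 : R0 <= R2 /\ 1 + 2 * M / nu <= R2)
    by (split; [apply Rmax_l | apply Rmax_r]).
  assert (HMnu : 0 <= 2 * M / nu).
  { apply Rmult_le_pos; [lra | left; apply Rinv_0_lt_compat; lra]. }
  assert (Hzero : forall r, R2 <= r -> sin (u r) = 0 /\ v r = 0).
  { intros r Hr; specialize (HQneg r ltac:(lra)).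
    destruct (Hc r ltac:(lra)) as [H1 [H2 [H3 H4]]].
    unfold Q, pohozaev, potential in HQneg.
    assert (HA : r ^ 2 * ((1 - cos (u r)) * (nu / 2)) <=
      r ^ 2 * ((1 - cos (u r)) * - (lam / 2 * (1 + cos (u r)) + om))).
    { apply Rmult_le_compat_l; [apply pow2_ge_0 |].
      apply Rmult_le_compat_l; lra. }
    assert (HC : M / 2 * sin (u r) ^ 2 <= M * (1 - cos (u r))).
    { rewrite sin_sq_factor. assert (0 <= M * (1 - cos (u r))) by nra. nra. }
    assert (HD : M < r ^ 2 * (nu / 2)).
    { assert (2 * M < r * nu).
      { assert (2 * M / nu < r) by lra.
        apply (Rmult_lt_compat_r nu) in H; [| lra].
        replace (2 * M / nu * nu) with (2 * M) in H by (field; lra). lra. }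
      assert (1 <= r) by lra. nra. }
    pose proof (pow2_ge_0 (r * v r)) as HF.
    assert (Hy : 1 - cos (u r) = 0) by nra.
    assert (Hsin : sin (u r) ^ 2 = 0) by (rewrite sin_sq_factor, Hy; ring).
    assert (sin (u r) = 0) by nra.
    split; auto.
    rewrite Hy, Hsin in HQneg.
    assert (r * v r = 0) by nra.
    apply Rmult_integral in H0; lra. }
  intros r Hr.
  destruct (Rle_dec R2 r) as [Hle | Hgt]; [apply Hzero, Hle |].
  destruct (Hzero R2 ltac:(lra)).
  apply (sin_zero_extends M lam om u v R2); auto; lra.
Qed.

(** * The integrable case lambda = omega = 0 *)
Definition vanishes_at_0 (f : R -> R) : Prop :=
  forall eps, 0 < eps -> exists delta, 0 < delta /\
    forall r, 0 < r < delta -> Rabs (f r) <= eps.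

Lemma constant_vanishing_at_0 f :
  (forall r, 0 < r -> is_derive f r 0) -> vanishes_at_0 f ->
  forall r, 0 < r -> f r = 0.
Proof.
  intros Hd H0 r Hr; apply Rabs_eq_0, Rle_antisym; [| apply Rabs_pos].
  apply Rnot_lt_le; intro Hp.
  destruct (H0 (Rabs (f r) / 2)) as [d [Hd0 Hs]]; [lra |].
  pose proof (Rmin_l r (d / 2)); pose proof (Rmin_r r (d / 2)).
  assert (Hm : 0 < Rmin r (d / 2)) by (apply Rmin_glb_lt; lra).
  specialize (Hs (Rmin r (d / 2)) ltac:(lra)).
  rewrite (eq_of_derive_zero f (Rmin r (d / 2)) r) in Hs; [lra | lra |].
  intros x Hx; apply Hd; lra.
Qed.

Lemma power_vanishes_at_0 C n : vanishes_at_0 (fun r => C * r ^ S n).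
Proof.
  intros eps He; pose proof (Rabs_pos C).
  exists (Rmin 1 (eps / (Rabs C + 1))); split.
  { apply Rmin_glb_lt; [lra | apply Rdiv_lt_0_compat; lra]. }
  intros r Hr.
  pose proof (Rmin_l 1 (eps / (Rabs C + 1))).
  pose proof (Rmin_r 1 (eps / (Rabs C + 1))).
  assert (Hr2 : r * (Rabs C + 1) <= eps) by (apply Rle_div_r; lra).
  rewrite Rabs_mult, (Rabs_pos_eq (r ^ S n)) by (apply pow_le; lra).
  assert (0 <= r ^ n <= 1).
  { split; [apply pow_le; lra |].
    rewrite <- (pow1 n); apply pow_incr; lra. }
  simpl; assert (r * r ^ n <= r) by nra. assert (0 <= r * r ^ n) by nra. nra.
Qed.

(** Let [p = S n]. Here [pohozaev] is constant, hence 0, which says that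
    [A B = 0] for [A = r v - p sin h] and [B = r v + p sin h]. Each factor solves
    a linear homogeneous equation and so vanishes identically if it vanishes
    once. If [B = 0], then [1 - cos h] is nonincreasing and starts at 0, so [h]
    is trivial. If [A = 0], then [sin (h/2) - C r^p cos (h/2)] solves a linear
    homogeneous equation for every [C]. Working with this expression rather than
    with [tan (h/2)] avoids dividing by [cos (h/2)]; choosing [C] so that it
    vanishes at one point makes it vanish everywhere, and the derivative of
    [h/2 - atan (C r^p)] is then 0. *)
Lemma harmonic_profile (n : nat) (h v : R -> R) :
  radial_solution (INR (S n) ^ 2) 0 0 h v -> regular_at_0 h v ->
  vanishes_at_0 h -> ~ (forall r, 0 < r -> sin (h r) = 0) ->
  exists C, forall r, 0 < r -> h r = 2 * atan (C * r ^ S n).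
Proof.
  intros Hs Hreg H0 Hne.
  set (p := INR (S n)) in *.
  assert (Hp : 0 < p) by (apply lt_0_INR; lia).
  assert (HQ : forall r, 0 < r ->
            (r * v r - p * sin (h r)) * (r * v r + p * sin (h r)) = 0).
  { intros r Hr.
    assert (HQ0 : pohozaev (p ^ 2) 0 0 h v r = 0).
    { revert r Hr; apply constant_vanishing_at_0.
      - intros r Hr.
        replace 0 with (2 * r * potential 0 0 (h r)) at 3
          by (unfold potential; field).
        apply is_derive_pohozaev; auto.
      - intros eps He.
        set (e := Rmin 1 (eps / (1 + p ^ 2))).
        assert (Hp2 : 0 < 1 + p ^ 2) by nra.
        assert (He' : 0 < e /\ e <= 1 /\ e * (1 + p ^ 2) <= eps).
        { unfold e; split; [apply Rmin_glb_lt;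
            [lra | apply Rdiv_lt_0_compat; lra] |].
          split; [apply Rmin_l |]. apply Rle_div_r; [lra | apply Rmin_r]. }
        destruct (Hreg e) as [d [Hd Hsm]]; [lra |].
        exists d; split; auto; intros r Hr.
        destruct (Hsm r Hr) as [H1 H2].
        apply Rabs_le_between in H1; apply Rabs_le_between in H2.
        unfold pohozaev, potential.
        assert (0 <= (r * v r) ^ 2 <= e) by (split; [apply pow2_ge_0 | nra]).
        assert (0 <= sin (h r) ^ 2 <= e) by (split; [apply pow2_ge_0 | nra]).
        pose proof (pow2_ge_0 p).
        assert (0 <= p ^ 2 / 2 * sin (h r) ^ 2 <= p ^ 2 * e) by (split; nra).
        apply Rabs_le; lra. }
    unfold pohozaev, potential in HQ0; lra. }
  assert (Hlin : forall s, (s = 1 \/ s = -1) -> forall r0, 0 < r0 ->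
     r0 * v r0 - s * p * sin (h r0) = 0 ->
     forall r, 0 < r -> r * v r - s * p * sin (h r) = 0).
  { intros s Hs1 r0 Hr0 Hz.
    apply (linear_ode_zero (fun r => r * v r - s * p * sin (h r))
      (fun r => - s * p * cos (h r)) p r0); [lra | auto | | | exact Hz].
    - intros r Hr; destruct (Hs r Hr) as [Hu Hv].
      auto_derive; [repeat split; eexists; eassumption |].
      use_derivatives.
      destruct Hs1 as [-> | ->]; field; lra.
    - intros r Hr; pose proof (COS_bound (h r)).
      apply Rabs_le; destruct Hs1 as [-> | ->]; nra. }
  specialize (HQ 1 Rlt_0_1) as HQ1.
  apply Rmult_integral in HQ1; destruct HQ1 as [HA | HB].
  2: { exfalso; apply Hne.
    assert (HB' : forall r, 0 < r -> r * v r = - p * sin (h r)).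
    { intros r Hr.
      pose proof (Hlin (-1) (or_intror eq_refl) 1 Rlt_0_1 ltac:(lra) r Hr); lra. }
    assert (Hle : forall a b, 0 < a <= b -> 1 - cos (h b) <= 1 - cos (h a)).
    { intros a b Hab; enough (- (1 - cos (h a)) <= - (1 - cos (h b))) by lra.
      apply (le_of_derive_nonneg (fun r => - (1 - cos (h r)))
        (fun r => - (v r * sin (h r)))); [lra | |]; intros x Hx.
      - apply (is_derive_opp (fun r => 1 - cos (h r)) x).
        eapply is_derive_one_minus_cos; eauto; lra.
      - specialize (HB' x ltac:(lra)).
        apply (Rmult_le_reg_l x); [lra |].
        replace (x * - (v x * sin (h x))) with (- (x * v x) * sin (h x)) by ring.
        rewrite HB'; pose proof (pow2_ge_0 (sin (h x))); nra. }
    intros r Hr.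
    assert (Hc : 1 - cos (h r) <= 0).
    { apply Rnot_lt_le; intro Hpos.
      destruct (H0 ((1 - cos (h r)) / 2)) as [d' [Hd' Hsm]]; [lra |].
      pose proof (Rmin_l r (d' / 2)); pose proof (Rmin_r r (d' / 2)).
      set (t := Rmin r (d' / 2)) in *.
      assert (Ht : 0 < t) by (apply Rmin_glb_lt; lra).
      specialize (Hsm t ltac:(lra)); specialize (Hle t r ltac:(lra)).
      pose proof (one_minus_cos_le_abs (h t)); lra. }
    pose proof (COS_bound (h r)).
    enough (sin (h r) ^ 2 = 0) by nra.
    rewrite sin_sq_factor; replace (1 - cos (h r)) with 0 by lra; ring. }
  assert (HA' : forall r, 0 < r -> v r = p * sin (h r) / r).
  { intros r Hr.
    pose proof (Hlin 1 (or_introl eq_refl) 1 Rlt_0_1 ltac:(lra) r Hr).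
    apply (Rmult_eq_reg_l r); [| lra]; field_simplify; lra. }
  destruct (H0 1 Rlt_0_1) as [d [Hd Hsm]].
  set (r0 := d / 2).
  assert (Hr0 : 0 < r0) by (unfold r0; lra).
  assert (Hcos : 0 < cos (h r0 / 2)).
  { specialize (Hsm r0 ltac:(unfold r0; lra)); apply Rabs_le_between in Hsm.
    pose proof PI2_1; apply cos_gt_0; lra. }
  assert (Hpw : forall r, 0 < r -> 0 < r ^ S n) by (intros; apply pow_lt; auto).
  exists (tan (h r0 / 2) / r0 ^ S n).
  set (C := tan (h r0 / 2) / r0 ^ S n).
  assert (Hdouble : forall r, sin (h r) = 2 * sin (h r / 2) * cos (h r / 2)).
  { intro r; rewrite <- sin_2a; f_equal; field. }
  assert (HE : forall r, 0 < r ->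
            sin (h r / 2) - C * r ^ S n * cos (h r / 2) = 0).
  { apply (linear_ode_zero
      (fun r => sin (h r / 2) - C * r ^ S n * cos (h r / 2))
      (fun r => p * cos (h r / 2) ^ 2) p r0); [lra | auto | | |].
    - intros r Hr; destruct (Hs r Hr) as [Hu _].
      auto_derive; [repeat split; eexists; eassumption |].
      use_derivatives; rewrite HA', Hdouble by auto.
      change (Nat.pred (S n)) with n.
      change (r ^ S n) with (r * r ^ n).
      pose proof (sin2_cos2 (h r / 2)) as Hsc; unfold Rsqr in Hsc.
      change (match n with O => 1 | S _ => INR n + 1 end) with (INR (S n)).
      fold p.
      replace (h r * / 2) with (h r / 2) by reflexivity.
      set (s := sin (h r / 2)) in *; set (c := cos (h r / 2)) in *.
      transitivity (p / r * (s * c ^ 2 - C * (r * r ^ n) * c * (1 - s * s))).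
      + field; lra.
      + replace (1 - s * s) with (c * c) by lra. field; lra.
    - intros r Hr; pose proof (COS_bound (h r / 2)).
      assert (0 <= cos (h r / 2) ^ 2 <= 1) by (split; [apply pow2_ge_0 | nra]).
      apply Rabs_le; nra.
    - unfold C, tan; specialize (Hpw r0 Hr0); field; lra. }
  assert (Hfin : forall r, 0 < r -> h r / 2 - atan (C * r ^ S n) = 0).
  { apply constant_vanishing_at_0.
    - intros r Hr; destruct (Hs r Hr) as [Hu _].
      auto_derive; [repeat split; eexists; eassumption |].
      use_derivatives; rewrite HA', Hdouble by auto.
      change (Nat.pred (S n)) with n.
      change (match n with O => 1 | S _ => INR n + 1 end) with (INR (S n)).
      fold p.
      specialize (HE r Hr).
      pose proof (sin2_cos2 (h r / 2)) as Hsc; unfold Rsqr in Hsc.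
      set (s := sin (h r / 2)) in *; set (c := cos (h r / 2)) in *.
      set (x := C * r ^ S n) in *.
      assert (Hs' : s = x * c) by lra.
      rewrite Hs' in Hsc |- *.
      assert (Hx : 0 < 1 + x ^ 2) by (pose proof (pow2_ge_0 x); lra).
      assert (Hc2 : c ^ 2 = / (1 + x ^ 2)).
      { apply (Rmult_eq_reg_r (1 + x ^ 2)); [| lra]. rewrite Rinv_l by lra. lra. }
      replace (p * (2 * (x * c) * c) / r) with (2 * p * x / r * c ^ 2)
        by (field; lra).
      rewrite Hc2; unfold x; simpl; field; simpl in Hx.
      split; [| lra]. unfold x in Hx; simpl in Hx; lra.
    - intros eps He.
      destruct (H0 (eps / 2)) as [d1 [Hd1 Hb1]]; [lra |].
      destruct (power_vanishes_at_0 C n (Rmin 1 (eps / 4))) as [d2 [Hd2 Hb2]].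
      { apply Rmin_glb_lt; lra. }
      exists (Rmin d1 d2); split; [apply Rmin_glb_lt; auto |]; intros r Hr.
      pose proof (Rmin_l d1 d2); pose proof (Rmin_r d1 d2).
      specialize (Hb1 r ltac:(lra)); specialize (Hb2 r ltac:(lra)).
      pose proof (Rmin_l 1 (eps / 4)); pose proof (Rmin_r 1 (eps / 4)).
      pose proof (atan_sub_id_cubic (C * r ^ S n)) as Hat.
      set (x := C * r ^ S n) in *.
      pose proof (Rabs_pos x).
      assert (Rabs x ^ 3 <= Rabs x).
      { assert (Rabs x ^ 2 <= 1) by nra. nra. }
      apply Rabs_le_between in Hb1.
      assert (Hat' : Rabs (atan x - x) <= eps / 4) by lra.
      assert (Hx : Rabs x <= eps / 4) by lra.
      apply Rabs_le_between in Hat'; apply Rabs_le_between in Hx.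
      apply Rabs_le; lra. }
  intros r Hr; specialize (Hfin r Hr); fold C; lra.
Qed.

(** * Taylor expansion at 0 *)
Lemma is_derive_of_D_in f f' x :
  0 < x -> D_in f f' nonneg_half_line x -> is_derive f x (f' x).
Proof.
  intros Hx HD; apply is_derive_Reals; intros eps He.
  destruct (HD eps He) as [d [Hd Hlim]]; simpl in Hlim; unfold R_dist in Hlim.
  assert (Hm : 0 < Rmin d x) by (apply Rmin_glb_lt; lra).
  exists (mkposreal _ Hm); intros t Ht0 Ht; simpl in Ht.
  pose proof (Rmin_l d x); pose proof (Rmin_r d x).
  pose proof (proj1 (Rabs_lt_between _ _) Ht).
  specialize (Hlim (x + t)).
  replace (x + t - x) with t in Hlim by ring.
  apply Hlim; repeat split; [unfold nonneg_half_line; lra | lra | lra].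
Qed.

Lemma continuous_at_0_of_continue_in f :
  continue_in f nonneg_half_line 0 -> vanishes_at_0 (fun r => f r - f 0).
Proof.
  intros Hc eps He; destruct (Hc eps He) as [d [Hd Hlim]].
  simpl in Hlim; unfold R_dist in Hlim.
  exists d; split; [lra |]; intros r Hr; left; apply Hlim.
  repeat split; [unfold nonneg_half_line; lra | lra |].
  rewrite Rminus_0_r, Rabs_pos_eq; lra.
Qed.

Lemma continue_in_of_nth_derivative n f g :
  is_continuous_nth_derivative_on nonneg_half_line n f g ->
  continue_in f nonneg_half_line 0.
Proof.
  intros [Hn Hg]; destruct n as [| n].
  - intros eps He; specialize (Hg 0 (Rle_refl 0) eps He) as [d [Hd Hl]].
    exists d; split; auto; intros x Hx.
    simpl in *; rewrite <- (Hn 0 (Rle_refl 0)), <- (Hn x) by apply Hx.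
    apply Hl, Hx.
  - destruct Hn as [f' [HD _]].
    apply (cont_deriv f f' nonneg_half_line 0), HD, Rle_refl.
Qed.

Definition little_o_pow (n : nat) (f : R -> R) : Prop :=
  forall eps, 0 < eps -> exists delta, 0 < delta /\
    forall r, 0 < r < delta -> Rabs (f r) <= eps * r ^ n.

Lemma little_o_pow_minus n f1 f2 :
  little_o_pow n f1 -> little_o_pow n f2 ->
  little_o_pow n (fun r => f1 r - f2 r).
Proof.
  intros H1 H2 eps He.
  destruct (H1 (eps / 2)) as [d1 [Hd1 Hb1]]; [lra |].
  destruct (H2 (eps / 2)) as [d2 [Hd2 Hb2]]; [lra |].
  exists (Rmin d1 d2); split; [apply Rmin_glb_lt; auto |]; intros r Hr.
  pose proof (Rmin_l d1 d2); pose proof (Rmin_r d1 d2).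
  specialize (Hb1 r ltac:(lra)); specialize (Hb2 r ltac:(lra)).
  unfold Rminus; eapply Rle_trans; [apply Rabs_triang |].
  rewrite Rabs_Ropp; lra.
Qed.

Lemma is_derive_poly_primitive (c c' : nat -> R) n r :
  (forall j, c' (S j) = c j / INR (S j)) ->
  is_derive (fun x => sum_f_R0 (fun j => c' j * x ^ j) (S n)) r
    (sum_f_R0 (fun j => c j * r ^ j) n).
Proof.
  intros Hc; induction n as [| n IH].
  - simpl; rewrite (Hc O); auto_derive; auto; simpl; field.
  - change (sum_f_R0 (fun j => c j * r ^ j) (S n))
      with (sum_f_R0 (fun j => c j * r ^ j) n + c (S n) * r ^ S n).
    apply (is_derive_plus
      (fun x => sum_f_R0 (fun j => c' j * x ^ j) (S n))
      (fun x => c' (S (S n)) * x ^ S (S n)) r); [exact IH |].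
    rewrite Hc; auto_derive; auto.
    change (match n with O => 1 | S _ => INR n + 1 end) with (INR (S n)).
    change (Nat.pred (S (S n))) with (S n).
    change (INR (S n) + 1) with (INR (S (S n))).
    simpl pow; field; apply not_0_INR; lia.
Qed.

Lemma poly_at_0 (c : nat -> R) n :
  sum_f_R0 (fun j => c j * 0 ^ j) n = c O.
Proof.
  induction n as [| n IH]; simpl; [ring |]. rewrite IH; ring.
Qed.

(** Only the top coefficient is identified, which keeps the lower derivatives out of the statement. In the induction step the
    polynomial for [f'] is integrated, and the mean value theorem on [[s, r]]
    with [s] tending to 0 bounds the remainder. *)
Lemma taylor_peano n : forall f g,
  is_continuous_nth_derivative_on nonneg_half_line n f g ->
  exists c : nat -> R, c n = g 0 / INR (fact n) /\
    little_o_pow n (fun r => f r - sum_f_R0 (fun j => c j * r ^ j) n).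
Proof.
  induction n as [| n IH]; intros f g Hfg.
  - destruct (Hfg) as [Hn _]; simpl in Hn.
    exists (fun _ => g 0); split; [simpl; field |].
    intros eps He.
    destruct (continuous_at_0_of_continue_in f
      (continue_in_of_nth_derivative _ _ _ Hfg) eps He) as [d [Hd Hb]].
    exists d; split; auto; intros r Hr; simpl.
    rewrite !Rmult_1_r, (Hn 0 (Rle_refl 0)); apply Hb, Hr.
  - pose proof (continuous_at_0_of_continue_in f
      (continue_in_of_nth_derivative _ _ _ Hfg)) as Hf0.
    destruct Hfg as [[f' [HD Hn]] Hg].
    destruct (IH f' g (conj Hn Hg)) as [c [Hcn Ho]].
    (* The primitive of the polynomial for [f'], with constant term [f 0]. *)
    set (c' := fun j => match j with O => f 0 | S i => c i / INR (S i) end).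
    assert (Hc' : forall j, c' (S j) = c j / INR (S j)) by reflexivity.
    exists c'; split.
    { rewrite Hc', Hcn, fact_simpl, mult_INR; field.
      split; [apply INR_fact_neq_0 | apply not_0_INR; lia]. }
    set (P := fun x => sum_f_R0 (fun j => c' j * x ^ j) (S n)).
    set (F := fun r => f r - P r).
    set (F' := fun r => f' r - sum_f_R0 (fun j => c j * r ^ j) n).
    assert (HP : forall r, is_derive P r (sum_f_R0 (fun j => c j * r ^ j) n))
      by (intro r; apply is_derive_poly_primitive, Hc').
    assert (HF : forall r, 0 < r -> is_derive F r (F' r)).
    { intros r Hr; apply (is_derive_minus f P r); [| apply HP].
      apply is_derive_of_D_in; [auto | apply HD; left; auto]. }
    assert (HF0 : vanishes_at_0 F).
    { intros eps He.
      destruct (Hf0 (eps / 2)) as [d1 [Hd1 Hb1]]; [lra |].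
      assert (HPc : continuity_pt P 0).
      { apply derivable_continuous_pt; eexists; apply is_derive_Reals, HP. }
      destruct (HPc (eps / 2)) as [d2 [Hd2 Hb2]]; [lra |].
      exists (Rmin d1 d2); split; [apply Rmin_glb_lt; auto |]; intros r Hr.
      pose proof (Rmin_l d1 d2); pose proof (Rmin_r d1 d2).
      specialize (Hb1 r ltac:(lra)); specialize (Hb2 r).
      simpl in Hb2; unfold R_dist in Hb2.
      assert (Hb3 : Rabs (P r - P 0) < eps / 2).
      { apply Hb2; repeat split; [lra |].
        rewrite Rminus_0_r, Rabs_pos_eq; lra. }
      unfold P at 2 in Hb3; rewrite poly_at_0 in Hb3.
      replace (F r) with ((f r - f 0) + - (P r - c' O))
        by (unfold F; simpl; ring).
      eapply Rle_trans; [apply Rabs_triang |]; rewrite Rabs_Ropp; lra. }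
    intros eps He; destruct (Ho (eps / 2)) as [d [Hd Hb]]; [lra |].
    exists d; split; auto; intros r Hr; fold (P r) (F r).
    assert (Hpw : 0 < r ^ S n) by (apply pow_lt; lra).
    destruct (HF0 (eps / 2 * r ^ S n)) as [d' [Hd' Hs]].
    { apply Rmult_lt_0_compat; lra. }
    pose proof (Rmin_l (r / 2) (d' / 2)); pose proof (Rmin_r (r / 2) (d' / 2)).
    set (s := Rmin (r / 2) (d' / 2)) in *.
    assert (Hs0 : 0 < s) by (apply Rmin_glb_lt; lra).
    specialize (Hs s ltac:(lra)).
    destruct (MVT_gen F s r F') as [x [Hx Heq]];
      rewrite ?Rmin_left, ?Rmax_right in * by lra.
    + intros x Hx; apply HF; lra.
    + intros x Hx; apply derivable_continuous_pt; eexists.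
      apply is_derive_Reals, HF; lra.
    + specialize (Hb x ltac:(lra)); fold (F' x) in Hb.
      assert (Hx2 : x ^ n <= r ^ n) by (apply pow_incr; lra).
      assert (HF'x : Rabs (F' x * (r - s)) <= eps / 2 * r ^ n * r).
      { rewrite Rabs_mult, (Rabs_pos_eq (r - s)) by lra.
        apply Rmult_le_compat; try lra; [apply Rabs_pos |]. nra. }
      replace (F r) with (F' x * (r - s) + F s) by lra.
      eapply Rle_trans; [apply Rabs_triang |].
      simpl in *; lra.
Qed.

Lemma poly_little_o_zero n : forall c : nat -> R,
  little_o_pow n (fun r => sum_f_R0 (fun j => c j * r ^ j) n) -> c n = 0.
Proof.
  induction n as [| n IH]; intros c Ho.
  - apply Rabs_eq_0, Rle_antisym; [| apply Rabs_pos].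
    apply le_epsilon; intros eps He.
    destruct (Ho eps He) as [d [Hd Hb]].
    specialize (Hb (d / 2) ltac:(lra)); simpl in Hb.
    rewrite !Rmult_1_r in Hb; lra.
  - assert (Hsplit : forall r, sum_f_R0 (fun j => c j * r ^ j) (S n)
       = c O + r * sum_f_R0 (fun j => c (S j) * r ^ j) n).
    { intro r; rewrite decomp_sum by lia; simpl pred.
      rewrite scal_sum; f_equal; [simpl; ring |].
      apply sum_eq; intros i _; simpl; ring. }
    assert (Hc0 : c O = 0).
    { set (P := fun x => sum_f_R0 (fun j => c j * x ^ j) (S n)).
      assert (HPc : continuity_pt P 0).
      { apply derivable_continuous_pt; eexists; apply is_derive_Reals.
        apply (is_derive_poly_primitive (fun j => c (S j) * INR (S j))).
        intro j; field; apply not_0_INR; lia. }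
      apply Rabs_eq_0, Rle_antisym; [| apply Rabs_pos].
      apply le_epsilon; intros eps He.
      destruct (HPc (eps / 2)) as [d2 [Hd2 Hb2]]; [lra |].
      destruct (Ho (eps / 2)) as [d1 [Hd1 Hb1]]; [lra |].
      set (r := Rmin (Rmin d1 d2) 1 / 2).
      pose proof (Rmin_l d1 d2); pose proof (Rmin_r d1 d2).
      pose proof (Rmin_l (Rmin d1 d2) 1); pose proof (Rmin_r (Rmin d1 d2) 1).
      assert (0 < Rmin (Rmin d1 d2) 1)
        by (repeat apply Rmin_glb_lt; lra).
      assert (Hr : 0 < r /\ r < d1 /\ r < d2 /\ r <= 1) by (unfold r; lra).
      specialize (Hb1 r ltac:(lra)); fold (P r) in Hb1.
      specialize (Hb2 r); simpl in Hb2; unfold R_dist in Hb2.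
      assert (Hb3 : Rabs (P r - P 0) < eps / 2).
      { apply Hb2; repeat split; [lra |].
        rewrite Rminus_0_r, Rabs_pos_eq; lra. }
      unfold P at 2 in Hb3; rewrite poly_at_0 in Hb3.
      assert (r ^ S n <= 1).
      { rewrite <- (pow1 (S n)); apply pow_incr; lra. }
      assert (Rabs (P r) <= eps / 2) by nra.
      replace (c O) with (P r + - (P r - c O)) by ring.
      eapply Rle_trans; [apply Rabs_triang |]; rewrite Rabs_Ropp; lra. }
    apply (IH (fun j => c (S j))); intros eps He.
    destruct (Ho eps He) as [d [Hd Hb]]; exists d; split; auto; intros r Hr.
    specialize (Hb r Hr); rewrite Hsplit, Hc0, Rplus_0_l, Rabs_mult,
      (Rabs_pos_eq r) in Hb by lra.
    apply (Rmult_le_reg_l r); [lra |]; simpl in Hb; lra.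
Qed.

(** The Taylor coefficients are unique, so an [n]-th order expansion found by any
    means yields the [n]-th derivative at 0. *)
Lemma nth_derivative_of_leading_term n f g L :
  is_continuous_nth_derivative_on nonneg_half_line n f g ->
  little_o_pow n (fun r => f r - L * r ^ n) ->
  g 0 = L * INR (fact n).
Proof.
  intros Hfg HL; destruct (taylor_peano n f g Hfg) as [c [Hcn Ho]].
  set (e := fun j => c j - if Nat.eqb j n then L else 0).
  assert (He : e n = 0).
  { apply poly_little_o_zero; intros eps He.
    destruct (little_o_pow_minus n _ _ HL Ho eps He) as [d [Hd Hb]].
    exists d; split; auto; intros r Hr; specialize (Hb r Hr).
    replace (sum_f_R0 (fun j => e j * r ^ j) n)
      with (f r - L * r ^ n - (f r - sum_f_R0 (fun j => c j * r ^ j) n)); auto.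
    enough (Hsum : sum_f_R0 (fun j => e j * r ^ j) n
       = sum_f_R0 (fun j => c j * r ^ j) n - L * r ^ n) by lra.
    clear; destruct n as [| n]; [unfold e; simpl; ring |].
    simpl sum_f_R0; unfold e at 2; rewrite Nat.eqb_refl.
    rewrite (sum_eq (fun j => e j * r ^ j) (fun j => c j * r ^ j) n);
      [simpl; ring |].
    intros i Hi; unfold e; rewrite (proj2 (Nat.eqb_neq i (S n))) by lia; ring. }
  unfold e in He; rewrite Nat.eqb_refl, Hcn in He.
  pose proof (INR_fact_neq_0 n).
  apply (Rmult_eq_reg_r (/ INR (fact n))); [| apply Rinv_neq_0_compat; auto].
  field_simplify; auto; lra.
Qed.

(** * From the initial value problem to the classification *)

(** Once [|u| <= 1], [1 - cos u = 2 sin^2 (u/2) >= u^2 / 8]. *)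
Lemma exponential_of_one_minus_cos u b k R0 :
  vanishes_at_infinity u -> 0 < b -> 0 < k -> 0 < R0 ->
  (forall r, R0 <= r -> 1 - cos (u r) <= b * exp (- k * r)) ->
  converges_exponentially_to u 0.
Proof.
  intros Hu Hb Hk HR0 Hdec.
  destruct (Hu 1 Rlt_0_1) as [R1 [HR1 Hsmall]].
  exists (8 * b + 1), (k / 2), (Rmax R0 R1).
  pose proof (Rmax_l R0 R1); pose proof (Rmax_r R0 R1).
  repeat split; try lra; intros r Hr.
  specialize (Hsmall r ltac:(lra)); specialize (Hdec r ltac:(lra)).
  assert (Hc : 1 - cos (u r) = 2 * sin (u r / 2) ^ 2).
  { replace (u r) with (2 * (u r / 2)) at 1 by field.
    rewrite cos_2a_sin; ring. }
  apply Rabs_le_between in Hsmall.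
  pose proof (half_le_abs_sin (u r / 2) ltac:(apply Rabs_le; lra)) as Hsin.
  replace (exp (- k * r)) with (exp (- (k / 2) * r) * exp (- (k / 2) * r)) in Hdec
    by (rewrite <- exp_plus; f_equal; field).
  pose proof (exp_pos (- (k / 2) * r)).
  set (e := exp (- (k / 2) * r)) in *.
  rewrite Rminus_0_r.
  assert (Hsq : u r ^ 2 <= ((8 * b + 1) * e) ^ 2).
  { assert (0 < e * e) by nra. nra. }
  assert (0 < (8 * b + 1) * e) by nra.
  apply Rabs_le; split; nra.
Qed.

Lemma mass_dichotomy M lam om u v :
  0 <= M -> radial_solution M lam om u v -> regular_at_0 u v ->
  vanishes_at_infinity u -> bounded_energy M u v ->
  ~ (forall r, 0 < r -> sin (u r) = 0) ->
  lam + om = 0 \/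
  (- lam < om /\ om < 0 /\ converges_exponentially_to u 0).
Proof.
  intros HM Hs H0 Hu HE Hne.
  destruct (Rtotal_order (lam + om) 0) as [Hneg | [Hz | Hpos]]; [| now left |].
  - exfalso; apply Hne.
    apply (sin_zero_of_negative_mass M lam om u v); auto.
  - right; split; [lra |]; split.
    + apply Rnot_le_lt; intro Hom; apply Hne.
      apply (sin_zero_of_nonneg_omega M lam om u v); auto.
    + destruct (exponential_decay_of_positive_mass M lam om u v)
        as [b [k [R0 [Hb [Hk [HR0 Hdec]]]]]]; auto.
      apply (exponential_of_one_minus_cos u b k R0); auto.
Qed.

Lemma radial_solution_of_ode lam om m h :
  (forall r, 0 < r -> twice_differentiable_at h r /\ satisfies_ode lam om m h r) ->
  radial_solution (IZR m ^ 2) lam om h (Derive h).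
Proof.
  intros Hh r Hr; destruct (Hh r Hr) as [[H1 H2] Hode]; split.
  - apply Derive_correct, H1.
  - unfold satisfies_ode in Hode.
    replace (sin (h r) * ((IZR m ^ 2 / r ^ 2 + lam) * cos (h r) + om)
       - Derive h r / r) with (Derive (Derive h) r) by (unfold Rdiv in *; lra).
    apply Derive_correct, H2.
Qed.

(** A translation by a multiple [c] of [PI] multiplies [sin] and [cos] by the same
    sign [cos c]; the sign cancels in [sin cos] and passes to [om] in the other
    term. *)
Lemma radial_solution_shift M lam om h v c :
  sin c = 0 -> radial_solution M lam om h v ->
  radial_solution M lam (cos c * om) (fun r => h r - c) v.
Proof.
  intros Hc Hs r Hr; destruct (Hs r Hr) as [H1 H2]; split.
  - auto_derive; [eexists; eassumption |]; use_derivatives; ring.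
  - rewrite sin_minus, cos_minus, Hc.
    pose proof (sin2_cos2 c) as Hc2; unfold Rsqr in Hc2; rewrite Hc in Hc2.
    replace ((sin (h r) * cos c - cos (h r) * 0) *
      ((M / r ^ 2 + lam) * (cos (h r) * cos c + sin (h r) * 0) + cos c * om)
      - v r / r) with
      (cos c * cos c * (sin (h r) * ((M / r ^ 2 + lam) * cos (h r) + om)) - v r / r)
      by ring.
    replace (cos c * cos c) with 1 by lra; rewrite Rmult_1_l; auto.
Qed.

Lemma bounded_energy_of_finite_energy lam om m h :
  radial_solution (IZR m ^ 2) lam om h (Derive h) -> finite_energy m h ->
  bounded_energy (IZR m ^ 2) h (Derive h).
Proof.
  intros Hs [l Hl].
  destruct (Hl (fun y => Rabs (y - l) < 1)) as [A B HA HB HAB].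
  { exists (mkposreal 1 Rlt_0_1); intros y Hy; exact Hy. }
  destruct HA as [d Hd]; destruct HB as [R0 HB].
  assert (HdA : A (d / 2)).
  { pose proof (cond_pos d); apply Hd; [| lra].
    unfold ball; simpl; unfold AbsRing_ball, abs, minus, plus, opp; simpl.
    rewrite Rabs_pos_eq; lra. }
  assert (Hd0 : 0 < d / 2) by (pose proof (cond_pos d); lra).
  exists (fun r => RInt (energy_density m h) (d / 2) r), (Rmax 1 (R0 + 1)),
    (Rabs l + 1).
  pose proof (Rmax_l 1 (R0 + 1)); pose proof (Rmax_r 1 (R0 + 1)).
  assert (Hcont : forall r, 0 < r -> continuous (energy_density m h) r).
  { intros r Hr; destruct (Hs r Hr) as [H1 H2].
    apply (@ex_derive_continuous R_AbsRing R_NormedModule (energy_density m h) r).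
    unfold energy_density; auto_derive.
    repeat split; try (eexists; eassumption); nra. }
  split; [lra |]; split.
  - intros r Hr.
    replace (r * Derive h r ^ 2 + IZR m ^ 2 / r * sin (h r) ^ 2)
      with (energy_density m h r) by (unfold energy_density; field; lra).
    apply (is_derive_RInt _ _ (d / 2)); [| apply Hcont, Hr].
    assert (Hr2 : 0 < r / 2) by lra.
    exists (mkposreal _ Hr2); intros t Ht.
    apply Rabs_lt_between in Ht; simpl in Ht; unfold minus, plus, opp in Ht;
      simpl in Ht.
    apply (@RInt_correct R_CompleteNormedModule).
    apply (@ex_RInt_continuous R_CompleteNormedModule).
    intros z Hz; apply Hcont.
    assert (0 < Rmin (d / 2) t) by (apply Rmin_glb_lt; lra); lra.
  - intros r Hr; destruct (HAB (d / 2) r HdA) as [y [Hy1 Hy2]].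
    { apply HB; lra. }
    simpl in Hy1; rewrite (is_RInt_unique _ _ _ _ Hy1).
    replace y with ((y - l) + l) by ring.
    eapply Rle_trans; [apply Rabs_triang | lra].
Qed.

Lemma eventually_close_of_lim h c :
  converges_to h c -> vanishes_at_infinity (fun r => h r - c).
Proof.
  intros Hl eps He.
  apply is_lim_spec in Hl; destruct (Hl (mkposreal eps He)) as [R0 HR0].
  exists (Rmax 1 (R0 + 1)).
  pose proof (Rmax_l 1 (R0 + 1)); pose proof (Rmax_r 1 (R0 + 1)).
  split; [lra |]; intros r Hr; left; apply HR0; lra.
Qed.

(** As [h] is [S n] times continuously differentiable with [S n >= 1], its
    derivative is bounded near 0, whence [r h'] tends to 0. *)
Lemma initial_regularity n h hm :
  (forall r, 0 < r -> ex_derive h r) -> h 0 = 0 ->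
  is_continuous_nth_derivative_on nonneg_half_line (S n) h hm ->
  vanishes_at_0 h /\ regular_at_0 h (Derive h).
Proof.
  intros Hex Hh0 Hn.
  assert (HV : vanishes_at_0 h).
  { intros eps He.
    destruct (continuous_at_0_of_continue_in h
      (continue_in_of_nth_derivative _ _ _ Hn) eps He) as [d [Hd Hb]].
    exists d; split; auto; intros r Hr; specialize (Hb r Hr).
    rewrite Hh0, Rminus_0_r in Hb; exact Hb. }
  split; auto.
  destruct Hn as [[h' [HD Hn]] Hg].
  destruct (continuous_at_0_of_continue_in h'
    (continue_in_of_nth_derivative _ _ _ (conj Hn Hg)) 1 Rlt_0_1)
    as [d1 [Hd1 Hb1]].
  intros eps He; destruct (HV eps He) as [d2 [Hd2 Hb2]].
  pose proof (Rabs_pos (h' 0)) as Hp.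
  set (d3 := eps / (Rabs (h' 0) + 1)).
  assert (Hd3 : 0 < d3 /\ d3 * (Rabs (h' 0) + 1) = eps).
  { unfold d3; split; [apply Rdiv_lt_0_compat; lra | field; lra]. }
  exists (Rmin d1 (Rmin d2 d3)); split; [repeat apply Rmin_glb_lt; lra |].
  intros r Hr.
  pose proof (Rmin_l d1 (Rmin d2 d3)); pose proof (Rmin_r d1 (Rmin d2 d3)).
  pose proof (Rmin_l d2 d3); pose proof (Rmin_r d2 d3).
  split.
  - eapply Rle_trans; [apply abs_sin_le | apply Hb2; lra].
  - specialize (Hb1 r ltac:(lra)).
    rewrite (is_derive_unique h r (h' r)).
    2: { apply is_derive_of_D_in; [lra |]. apply HD; left; lra. }
    assert (Hbd : Rabs (h' r) <= Rabs (h' 0) + 1).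
    { replace (h' r) with ((h' r - h' 0) + h' 0) by ring.
      eapply Rle_trans; [apply Rabs_triang | lra]. }
    rewrite Rabs_mult, (Rabs_pos_eq r) by lra.
    pose proof (Rabs_pos (h' r)); nra.
Qed.

(** If [sin h = 0] throughout, differentiation gives [h' = 0], so [h] is
    identically 0 and all its derivatives at 0 vanish. *)
Lemma sin_zero_impossible M lam om n h v hm :
  radial_solution M lam om h v -> vanishes_at_0 h ->
  is_continuous_nth_derivative_on nonneg_half_line n h hm ->
  hm 0 <> 0 -> ~ (forall r, 0 < r -> sin (h r) = 0).
Proof.
  intros Hs H0 Hn Hne Hz; apply Hne.
  assert (Hh : forall r, 0 < r -> h r = 0).
  { apply constant_vanishing_at_0; auto.
    intros r Hr; destruct (Hs r Hr) as [Hu _].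
    enough (Hv : v r = 0) by (rewrite <- Hv; exact Hu).
    assert (HD : is_derive (fun x => sin (h x)) r (v r * cos (h r))).
    { auto_derive; [eexists; eassumption |]; use_derivatives; ring. }
    assert (HD0 : is_derive (fun x => sin (h x)) r 0).
    { apply (is_derive_ext_loc (fun _ => 0)); [| apply (is_derive_const 0)].
      exists (mkposreal r Hr); intros t Ht.
      apply Rabs_lt_between in Ht; simpl in Ht; unfold minus, plus, opp in Ht;
        simpl in Ht.
      symmetry; apply Hz; lra. }
    apply is_derive_unique in HD; apply is_derive_unique in HD0.
    rewrite HD in HD0; apply Rmult_integral in HD0; destruct HD0 as [| Hc]; auto.
    pose proof (sin2_cos2 (h r)) as Hsc; unfold Rsqr in Hsc.
    rewrite (Hz r Hr), Hc in Hsc; lra. }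
  rewrite (nth_derivative_of_leading_term n h hm 0 Hn); [ring |].
  intros eps He; exists 1; split; [lra |]; intros r Hr.
  rewrite Hh by lra; rewrite Rmult_0_l, Rminus_0_r, Rabs_R0.
  apply Rmult_le_pos; [lra | apply pow_le; lra].
Qed.

Lemma atan_leading_term C n :
  little_o_pow (S n) (fun r => 2 * atan (C * r ^ S n) - 2 * C * r ^ S n).
Proof.
  intros eps He.
  set (e := eps / (2 * (Rabs C + 1))).
  pose proof (Rabs_pos C) as HC.
  assert (He' : 0 < e /\ e * (2 * (Rabs C + 1)) = eps).
  { unfold e; split; [apply Rdiv_lt_0_compat; lra | field; lra]. }
  destruct (power_vanishes_at_0 C n (Rmin 1 e)) as [d [Hd Hb]];
    [apply Rmin_glb_lt; lra |].
  exists d; split; auto; intros r Hr; specialize (Hb r Hr).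
  pose proof (Rmin_l 1 e); pose proof (Rmin_r 1 e).
  assert (Hpw : 0 < r ^ S n) by (apply pow_lt; lra).
  pose proof (atan_sub_id_cubic (C * r ^ S n)) as Hat.
  assert (Hx : Rabs (C * r ^ S n) = Rabs C * r ^ S n)
    by (rewrite Rabs_mult, (Rabs_pos_eq (r ^ S n)); lra).
  replace (2 * atan (C * r ^ S n) - 2 * C * r ^ S n)
    with (2 * (atan (C * r ^ S n) - C * r ^ S n)) by ring.
  rewrite Rabs_mult, (Rabs_pos_eq 2) by lra.
  set (x := Rabs (C * r ^ S n)) in *.
  assert (0 <= x) by apply Rabs_pos.
  assert (x ^ 3 <= e * x).
  { assert (x ^ 2 <= e) by nra. nra. }
  apply Rle_trans with (2 * (e * x)); [lra |].
  rewrite Hx, <- (proj2 He').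
  assert (0 <= e * r ^ S n) by (apply Rmult_le_pos; lra).
  nra.
Qed.

Lemma harmonic_explicit n a h v hm :
  radial_solution (INR (S n) ^ 2) 0 0 h v -> h 0 = 0 ->
  vanishes_at_0 h -> regular_at_0 h v ->
  is_continuous_nth_derivative_on nonneg_half_line (S n) h hm ->
  hm 0 = a -> a <> 0 ->
  forall r, 0 <= r -> h r = 2 * atan (a / (2 * INR (fact (S n))) * r ^ S n).
Proof.
  intros Hs Hh0 HV Hreg Hn <- Ha.
  destruct (harmonic_profile n h v Hs Hreg HV) as [C HC].
  { eapply sin_zero_impossible; eauto. }
  assert (HaC : hm 0 = 2 * C * INR (fact (S n))).
  { apply (nth_derivative_of_leading_term (S n) h hm); auto.
    intros eps He; destruct (atan_leading_term C n eps He) as [d [Hd Hb]].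
    exists d; split; auto; intros r Hr.
    rewrite HC by lra; apply Hb, Hr. }
  intros r Hr; rewrite HaC.
  replace (2 * C * INR (fact (S n)) / (2 * INR (fact (S n)))) with C
    by (field; apply INR_fact_neq_0).
  destruct Hr as [Hr | <-]; [apply HC, Hr |].
  rewrite Hh0, pow_i, Rmult_0_r, atan_0 by lia; ring.
Qed.

Lemma trig_at_multiple_of_pi k :
  sin (IZR k * PI) = 0 /\
  ((exists l, k = (2 * l)%Z) /\ cos (IZR k * PI) = 1 \/
   (exists l, k = (2 * l + 1)%Z) /\ cos (IZR k * PI) = -1).
Proof.
  assert (Hsin : forall j, sin (IZR j * PI) = 0)
    by (intro j; apply sin_eq_0_1; exists j; reflexivity).
  assert (Heven : forall l, cos (IZR (2 * l) * PI) = 1).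
  { intro l; rewrite mult_IZR, Rmult_assoc, cos_2a_sin, Hsin; ring. }
  split; [apply Hsin |].
  destruct (Z.Even_or_Odd k) as [[l ->] | [l ->]]; [left | right];
    (split; [now exists l |]); [apply Heven |].
  rewrite plus_IZR, Rmult_plus_distr_r, Rmult_1_l, neg_cos, Heven; ring.
Qed.

Lemma converges_exponentially_to_shift h c :
  converges_exponentially_to (fun r => h r - c) 0 -> converges_exponentially_to h c.
Proof.
  intros [b [e [R0 [Hb [He [HR0 H]]]]]]; exists b, e, R0.
  repeat split; auto; intros r Hr; specialize (H r Hr).
  now rewrite Rminus_0_r in H.
Qed.

Theorem theorem1p1 :
  forall (lambda omega : R) (m : Z) (a : R) (h : R -> R),
    m <> 0%Z ->
    a <> 0 ->
    is_solution lambda omega m a h ->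
    is_vortex h ->
    finite_energy m h ->
    exactly_one
      [ lambda = 0 /\ omega = 0 /\
        (forall r, 0 <= r ->
           h r = 2 * atan (a / (2 * INR (fact (Z.abs_nat m))) * r ^ Z.abs_nat m));
        lambda = omega /\ omega <> 0 /\
        (exists l : Z, converges_to h (IZR (2 * l + 1) * PI));
        lambda = - omega /\ - omega <> 0 /\
        (exists l : Z, converges_to h (IZR (2 * l) * PI));
        0 < omega /\ omega < lambda /\
        (exists l : Z, converges_exponentially_to h (IZR (2 * l + 1) * PI));
        - lambda < omega /\ omega < 0 /\
        (exists l : Z, converges_exponentially_to h (IZR (2 * l) * PI)) ].
Proof.
  intros lambda omega m a h Hm Ha [Hode [Hh0 [hm [Hn Hhm]]]] [k Hk] HE.
  set (M := IZR m ^ 2).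
  assert (HM : 0 <= M) by apply pow2_ge_0.
  destruct (Z.abs_nat m) as [| n] eqn:Habs; [lia |].
  assert (HMn : M = INR (S n) ^ 2).
  { unfold M; rewrite <- Habs, INR_IZR_INZ, Zabs2Nat.id_abs, abs_IZR.
    symmetry; apply pow2_abs. }
  set (v := Derive h).
  assert (Hs : radial_solution M lambda omega h v)
    by now apply radial_solution_of_ode.
  destruct (initial_regularity n h hm) as [HV Hreg]; auto.
  { intros r Hr; apply (Hode r Hr). }
  assert (Hne : ~ (forall r, 0 < r -> sin (h r) = 0)).
  { eapply sin_zero_impossible; eauto; lra. }
  destruct (trig_at_multiple_of_pi k) as [Hsin Hpar].
  set (c := IZR k * PI) in *.
  set (u := fun r => h r - c).
  assert (Hsu : forall r, sin (u r) = cos c * sin (h r)).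
  { intro r; unfold u; rewrite sin_minus, Hsin; ring. }
  assert (Hc1 : cos c * cos c = 1) by (destruct Hpar as [[_ ->] | [_ ->]]; ring).
  assert (Hcase : lambda + cos c * omega = 0 \/
    (- lambda < cos c * omega /\ cos c * omega < 0 /\
     converges_exponentially_to h c)).
  { destruct (mass_dichotomy M lambda (cos c * omega) u v)
      as [Hz | [H1 [H2 H3]]]; auto.
    - now apply radial_solution_shift.
    - intros eps He; destruct (Hreg eps He) as [d [Hd Hb]].
      exists d; split; auto; intros r Hr; destruct (Hb r Hr) as [Hb1 Hb2].
      split; auto; rewrite Hsu, Rabs_mult.
      replace (Rabs (cos c)) with 1
        by (destruct Hpar as [[_ ->] | [_ ->]];
            [rewrite Rabs_R1 | rewrite Rabs_left]; lra).
      lra.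
    - now apply eventually_close_of_lim.
    - destruct (bounded_energy_of_finite_energy lambda omega m h Hs HE)
        as [T [R0 [B [HR0 [HT HB]]]]].
      exists T, R0, B; split; [auto | split; auto]; intros r Hr.
      rewrite Hsu, Rpow_mult_distr.
      replace (cos c ^ 2) with 1 by lra; rewrite Rmult_1_l; apply HT, Hr.
    - intro Hz; apply Hne; intros r Hr; specialize (Hz r Hr).
      rewrite Hsu in Hz; apply Rmult_integral in Hz; destruct Hz; [nra | auto].
    - right; repeat split; auto; now apply converges_exponentially_to_shift. }
  set (Ps := [ lambda = 0 /\ _; _; _; _; _ ]).
  assert (Hsome : exists i, nth i Ps False).
  { destruct (Req_dec lambda 0) as [Hl | Hl];
      destruct Hpar as [[[l Hkl] Hcc] | [[l Hkl] Hcc]];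
      rewrite Hcc in Hcase; unfold c in *; subst k;
      destruct Hcase as [Hz | [H1 [H2 H3]]]; try lra.
    1, 2: exists 0%nat; simpl; split; [auto |]; split; [lra |];
      assert (Hom : omega = 0) by lra; rewrite Hl, Hom, HMn in Hs;
      apply (harmonic_explicit n a h v hm); auto.
    - exists 2%nat; simpl; repeat split; try lra; now exists l.
    - exists 4%nat; simpl; repeat split; try lra; now exists l.
    - exists 1%nat; simpl; repeat split; try lra; now exists l.
    - exists 3%nat; simpl; repeat split; try lra; now exists l. }
  destruct Hsome as [i Hi]; exists i; split; auto; intros j Hj.
  destruct i as [| [| [| [| [| i]]]]]; simpl in Hi;
    destruct j as [| [| [| [| [| j]]]]]; simpl in Hj; auto; exfalso;
    try lra; try (destruct i; assumption); destruct j; assumption.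
Qed.
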